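(* Let $m$ be a positive integer. Then there exists a constant $c>0$ such that for every nondecreasing function $\omega:(0,\infty)\to(0,\infty)$ satisfying $$\lim_{x\to0}\omega(x)=0\quad\text{and}\quad\omega(2x)\le2^m\omega(x)\ \text{ for } x>0,$$ for every $f\in(\Lambda_{\omega,m})_+$, and for arbitrary contractions $T$ and $R$ on Hilbert space the following inequality holds: $$\left\|\sum_{k=0}^m(-1)^k\binom mk f\left(T+\frac km(R-T)\right)\right\|\le c\,\|f\|_{\Lambda_{\omega,m}}\,\omega_{*,m}\big(\|T-R\|\big).$$
   Context: Let $\mathbb T$ be the unit circle. For $\tau\in\mathbb T$ put $(\Delta_\tau f)(\zeta)=f(\tau\zeta)-f(\zeta)$, $\zeta\in\mathbb T$, and let $\Delta_\tau^m$ be its $m$-th power. $\Lambda_{\omega,m}$ is the space of continuous functions $f$ on $\mathbb T$ such that $$\|f\|_{\Lambda_{\omega,m}}=\sup_{\tau\ne1,\;\zeta\in\mathbb T}\frac{|(\Delta_\tau^mf)(\zeta)|}{\omega(|1-\tau|)}<\infty ,$$ and $(\Lambda_{\omega,m})_+$ is the set of $f\in\Lambda_{\omega,m}$ with Fourier coefficients $\hat f(n)=0$ for $n<0$; such functions extend to functions in the disk algebra $C_A$ (functions continuous on the closed unit disk and analytic in its interior). For $x>0$, $\omega_{*,m}(x)=x^m\int_x^\infty\frac{\omega(t)}{t^{m+1}}\,dt$ (possibly $+\infty$), and $\omega_{*,m}(0)=0$. A contraction is an operator of norm at most $1$. For a contraction $T$ and $f\in C_A$, $f(T)$ is defined by the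 extension of the polynomial functional calculus to $C_A$ by means of von Neumann's inequality $\|f(T)\|\le\|f\|_{C_A}$. *)

(* Defs.v *)
From HB Require Import structures.
From mathcomp Require Import all_boot all_order all_algebra.
From mathcomp Require Import complex.
From mathcomp Require Import all_classical all_reals all_analysis.

Set Implicit Arguments.
Unset Strict Implicit.
Unset Printing Implicit Defensive.
Import Order.TTheory GRing.Theory Num.Theory.
Import numFieldNormedType.Exports.
Local Open Scope classical_set_scope.
Local Open Scope complex_scope.
Local Open Scope ring_scope.

(* [numFieldNormedType] only covers abstract number fields. *)
HB.instance Definition _ (R : realType) := NormedModule.copy R[i] R[i]^o.

(* The library norm of a vector space over R[i] takes values in R[i] (real and
   nonnegative there); [rnorm] is the same norm with values in R.  It also
   applies to V := R[i], where it is the modulus. *)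
Definition rnorm (R : realType) (V : normedZmodType R[i]) (x : V) : R :=
  complex.Re `|x|.

HB.mixin Record CompleteNormedModule_isHilbert (R : realType) H
    of CompleteNormedModule R[i] H := {
  inner : {dot H for (@Num.conj R[i])};
  inner_normE : forall x : H, inner x x = `|x| ^+ 2
}.

#[short(type="hilbertType")]
HB.structure Definition Hilbert (R : realType) :=
  {H of CompleteNormedModule R[i] H & CompleteNormedModule_isHilbert R H}.

Section Circle.
Context {R : realType}.
Implicit Types (f F : R[i] -> R[i]) (omega : R -> R) (m : nat).

Definition circle : set R[i] := [set z | `|z| = 1].

Definition closed_disk : set R[i] := [set z | `|z| <= 1].

Definition cis (t : R) : R[i] := cos t +i* sin t.

(* Functions on the circle are represented by functions on R[i] whose values
   off the circle are never used. *)
Definition Delta (tau : R[i]) f : R[i] -> R[i] :=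
  fun zeta => f (tau * zeta) - f zeta.

Definition Lambda_norm omega m f : \bar R :=
  ereal_sup [set y | exists tau zeta : R[i],
    [/\ circle tau, tau != 1, circle zeta &
     y = (rnorm (iter m (Delta tau) f zeta) / omega (rnorm (1 - tau)))%:E]].

Definition Lambda omega m f : Prop :=
  {within circle, continuous f} /\ (Lambda_norm omega m f < +oo)%E.

Definition cintegral (a b : R) (g : R -> R[i]) : R[i] :=
  Rintegral lebesgue_measure `[a, b] (fun t => complex.Re (g t)) +i*
  Rintegral lebesgue_measure `[a, b] (fun t => complex.Im (g t)).

Definition fourier f (n : int) : R[i] :=
  (2 * pi)%:C^-1 * cintegral 0 (2 * pi) (fun t => f (cis t) * cis (- (n%:~R * t))).

Definition Lambda_plus omega m f : Prop :=
  Lambda omega m f /\ forall n : int, n < 0 -> fourier f n = 0.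

(* For f continuous on the circle with vanishing negative Fourier coefficients,
   the function of the disk algebra that extends f: its Taylor coefficients at 0
   are the Fourier coefficients of its boundary values.  Values outside the
   closed disk are never used. *)
Definition disk_ext f : R[i] -> R[i] := fun z =>
  if `|z| < 1 then limn (series (fun n : nat => fourier f n%:Z * z ^+ n))
  else f z.

(* For nondecreasing omega > 0 the integrand is nonnegative and measurable, so
   the Lebesgue integral is defined, possibly equal to +oo. *)
Definition omega_star omega m (x : R) : \bar R :=
  if x == 0 then 0%E
  else ((x ^+ m)%:E *
    \int[lebesgue_measure]_(t in `[x, +oo[) (omega t / t ^+ m.+1)%:E)%E.

End Circle.

Section Operators.
Context {R : realType} {H : hilbertType R}.
Implicit Types (A T : H -> H).

Definition opnorm A : \bar R :=
  ereal_sup [set (rnorm (A x))%:E | x in [set x : H | `|x| <= 1]].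

Definition op_contraction T : Prop := (opnorm T <= 1)%E.

Definition poly_calc (p : {poly R[i]}) T : H -> H :=
  \sum_(i < size p) p`_i *: iter i T.

(* A = F(T): the polynomials are dense in the disk algebra and, for a
   contraction T, von Neumann's inequality makes the norm limit exist and be
   independent of the approximating sequence. *)
Definition is_disk_calc (F : R[i] -> R[i]) T A : Prop :=
  linear A /\ exists p : nat -> {poly R[i]},
    {uniform closed_disk, (fun n z => (p n).[z]) @ \oo --> F} /\
    opnorm (poly_calc (p n) T - A) @[n --> \oo] --> 0%E.

Definition disk_calc (F : R[i] -> R[i]) T : H -> H :=
  get [set A | is_disk_calc F T A].

End Operators.

(* Main.v *)
(** A polynomial in a contraction obeys von Neumann's inequality.  If p has
    degree at most N and |s| <= 1 / (N ||R - T||), then T + s (R - T) has norm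
    at most 1 + 1/N, so p (T + s (R - T)) has norm at most e max |p|; Cauchy's
    estimates for the coefficients of this polynomial in s bound its m-th
    difference by c (N ||R - T||)^m max |p|.  On the other hand, averaging f
    against Jackson kernels gives analytic polynomials P_n of degree
    O(2^n) with |f - P_n| <= c ||f|| omega(2^-n).  Write f as P_0 plus the blocks
    P_(j+1) - P_j with 2^(j+1) of order at most 1 / ||R - T|| plus a remainder:
    the bounds on the blocks sum up to a Riemann sum of omega_{*,m}, and the
    remainder is handled by von Neumann's inequality alone. *)
Require Import Defs.
From mathcomp Require Import all_boot all_order all_algebra.
From mathcomp Require Import complex.
From mathcomp Require Import all_classical all_reals all_analysis.
From mathcomp Require Import measurable_realfun ring lra.

Import Order.TTheory GRing.Theory Num.Theory.
Import numFieldNormedType.Exports.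
Local Open Scope classical_set_scope.
Local Open Scope complex_scope.
Local Open Scope ring_scope.

(** * Modulus and roots of unity *)

Section ComplexNorm.
Context {R : realType}.
Implicit Types V : normedZmodType R[i].

(** Only finite Fourier analysis stands behind von Neumann's inequality here: the defects
    [|T^n x|^2 - |T^(n+1) x|^2] are values of a positive semidefinite form and telescope, a
    polynomial in [T] acts on the sequence [T^n x] as a correlation, and Parseval's identity over
    roots of unity bounds correlations. The maximum principle is the one-dimensional case, and
    Cauchy's estimates are again averages over roots of unity.

    The two contractions need not commute, so the coefficients of [p (T + s (R - T))] in [s] are
    controlled only through such estimates. The difference is small because it annihilates the
    powers of [s] below [m]; the condition [N ||R - T|| <= 1/2] sums the others.

    The right-hand side contains only a seminorm that ignores constants, so no bound for [f] itself
    is at hand. This is why [P_0] has to be an exact constant, on which the difference vanishes. The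
    Jackson kernel is the [2 (m + 1)]-th power of the modulus of a Dirichlet kernel, enough to
    compensate the growth of order [m] that the doubling condition permits [omega]. *)

Lemma rnormE V (x : V) : (rnorm x)%:C = `|x|.
Proof. exact: RRe_real (normr_real x). Qed.

Lemma rnorm_ge0 V (x : V) : 0 <= rnorm x.
Proof. by rewrite -ler0c rnormE. Qed.

Lemma rnormD_le V (x y : V) : rnorm (x + y) <= rnorm x + rnorm y.
Proof.
have := ler_normD x y; rewrite -!rnormE -(rmorphD (real_complex R)).
by rewrite lecR.
Qed.

Lemma rnormN V (x : V) : rnorm (- x) = rnorm x.
Proof. by rewrite /rnorm normrN. Qed.

Lemma rnormB_le V (x y : V) : rnorm (x - y) <= rnorm x + rnorm y.
Proof. by rewrite -(rnormN _ y) rnormD_le. Qed.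

Lemma rnorm_distC V (x y : V) : rnorm (x - y) = rnorm (y - x).
Proof. by rewrite /rnorm distrC. Qed.

Lemma rnorm0 V : rnorm (0 : V) = 0.
Proof. by rewrite /rnorm normr0. Qed.

Lemma rnorm_eq0 V (x : V) : rnorm x = 0 -> x = 0.
Proof. by move=> h; apply: normr0_eq0; rewrite -rnormE h. Qed.

Lemma rnorm_sum V (I : Type) (r : seq I) (P : pred I) (F : I -> V) :
  rnorm (\sum_(i <- r | P i) F i) <= \sum_(i <- r | P i) rnorm (F i).
Proof.
rewrite -lecR (rmorph_sum (real_complex R)) rnormE (eq_bigr (fun i => `|F i|))
    ?ler_norm_sum //.
by move=> i _; exact: rnormE.
Qed.

Lemma rnormZ (V : normedModType R[i]) a (x : V) :
  rnorm (a *: x) = rnorm a * rnorm x.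
Proof. by apply: complexI; rewrite (rmorphM (real_complex R)) /= !rnormE normrZ. Qed.

Lemma rnormM (a b : R[i]) : rnorm (a * b) = rnorm a * rnorm b.
Proof. by apply: complexI; rewrite (rmorphM (real_complex R)) /= !rnormE normrM. Qed.

Lemma rnormX (a : R[i]) n : rnorm (a ^+ n) = rnorm a ^+ n.
Proof. by apply: complexI; rewrite (rmorphXn (real_complex R)) /= !rnormE normrX. Qed.

Lemma rnormR (a : R) : rnorm a%:C = `|a|.
Proof. by rewrite /rnorm normc_def /= expr0n addr0 sqrtr_sqr. Qed.

Lemma rnorm1 : rnorm (1 : R[i]) = 1.
Proof. by rewrite /rnorm normr1. Qed.

Lemma rnorm_conj (a : R[i]) : rnorm (a^*) = rnorm a.
Proof. by rewrite /rnorm norm_conjC. Qed.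

Lemma rnorm_Re (a : R[i]) : `|complex.Re a| <= rnorm a.
Proof. by rewrite -lecR rnormE normc_ge_Re. Qed.

Lemma rnorm_Im (a : R[i]) : `|complex.Im a| <= rnorm a.
Proof.
have := rnorm_Re (a * 'i); rewrite ReiNIm normrN rnormM.
suff -> : rnorm ('i : R[i]) = 1 by rewrite mulr1.
by rewrite /rnorm normc_def /= expr0n expr1n add0r sqrtr1.
Qed.

Lemma rnorm_le_ReIm (a : R[i]) :
  rnorm a <= `|complex.Re a| + `|complex.Im a|.
Proof.
rewrite {1}[a]complexE (le_trans (rnormD_le _ _ _))// rnormM !rnormR.
by rewrite [rnorm 'i]/rnorm normc_def /= expr0n expr1n add0r sqrtr1 mul1r.
Qed.

Lemma realc_eq0 (x : R) : (x%:C == 0 :> R[i]) = (x == 0).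
Proof. by rewrite eq_complex /= eqxx andbT. Qed.

Lemma Re_le (a b : R[i]) : a <= b -> complex.Re a <= complex.Re b.
Proof. by rewrite lecE => /andP[]. Qed.

Lemma Re_rM (k : R) (a : R[i]) : complex.Re (k%:C * a) = k * complex.Re a.
Proof. by case: a => x y /=; rewrite mul0r subr0. Qed.

Lemma Re_sum (I : Type) (r : seq I) (P : pred I) (F : I -> R[i]) :
  complex.Re (\sum_(i <- r | P i) F i) = \sum_(i <- r | P i) complex.Re (F i).
Proof. exact: (raddf_sum (@complex.Re R : Rcomplex R -> R)). Qed.

End ComplexNorm.

Section Cis.
Context {R : realType}.
Implicit Types a b : R.

Lemma cis0 : cis (0 : R) = 1.
Proof. by rewrite /cis cos0 sin0. Qed.

Lemma cisD a b : cis (a + b) = cis a * cis b.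
Proof. by rewrite /cis cosD sinD; simpc; rewrite (addrC (cos a * sin b)). Qed.

Lemma conj_cis a : (cis a)^* = cis (- a).
Proof. by rewrite /cis cosN sinN. Qed.

Lemma norm_cis a : `|cis a| = 1.
Proof. by rewrite normc_def /= cos2Dsin2 sqrtr1. Qed.

Lemma rnorm_cis a : rnorm (cis a) = 1.
Proof. by rewrite /rnorm norm_cis. Qed.

Lemma cisX a n : cis a ^+ n = cis (n%:R * a).
Proof.
elim: n => [|n IH]; first by rewrite expr0 mul0r cis0.
by rewrite exprS IH -cisD mulrSr mulrDl mul1r addrC.
Qed.

Lemma cis2pi : cis (2 * pi : R) = 1.
Proof. by rewrite /cis mulrC -[X in pi * X]/(1 *+ 2) mulrnAr mulr1 cos2pi sin2pi. Qed.

(** Conjugation and the reflection [2 * pi - a] reduce to [0 <= a <= pi], where [cos] is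
    injective. *)
Lemma cis_eq1 a : - (2 * pi) < a < 2 * pi -> cis a = 1 -> a = 0.
Proof.
have pos b : 0 <= b <= pi -> cis b = 1 -> b = 0.
  move=> hb [cb _]; apply: cos_inj; rewrite ?cb ?cos0 ?in_itv //=.
  by rewrite lexx pi_ge0.
move=> /andP[h1 h2] ca; wlog a0 : a h1 h2 ca / 0 <= a.
  move=> H; have [|/ltW a0] := leP 0 a; first exact: H.
  apply/eqP; rewrite -oppr_eq0; apply/eqP/H; rewrite ?oppr_ge0 //.
  - by rewrite ltrN2.
  - by rewrite ltrNl.
  - by rewrite -conj_cis ca conjC1.
have [ap|/ltW ap] := leP a pi; first by apply: pos; rewrite ?a0.
suff : 2 * pi - a = 0 by lra.
apply: pos; first by apply/andP; split; lra.
by rewrite cisD cis2pi mul1r -conj_cis ca conjC1.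
Qed.

Lemma cis_surj (z : R[i]) : circle z -> exists t : R, z = cis t.
Proof.
rewrite /circle /= => zn; have z0 : z != 0 by rewrite -normr_eq0 zn oner_neq0.
case: z zn z0 => x y; rewrite normc_def => -[] h _.
have h2 : x ^+ 2 + y ^+ 2 = 1.
  rewrite -(@sqr_sqrtr _ (x ^+ 2 + y ^+ 2)) ?addr_ge0 ?sqr_ge0 // h.
  by rewrite expr1n.
have xb : -1 <= x <= 1.
  rewrite -ler_norml -[leRHS]sqrtr1 -sqrtr_sqr ler_sqrt // -h2.
  by rewrite lerDl sqr_ge0.
have ys : `|y| = Num.sqrt (1 - x ^+ 2).
  by rewrite -sqrtr_sqr -h2; congr Num.sqrt; rewrite addrAC subrr add0r.
have [y0|y0] := leP 0 y.
  exists (acos x); rewrite /cis acosK ?in_itv //= sin_acos // -ys ger0_norm //.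
exists (- acos x); rewrite /cis cosN sinN acosK ?in_itv //= sin_acos //.
by rewrite -ys ltr0_norm // opprK.
Qed.

End Cis.

(** * Characters of a finite cyclic group *)

Section DiscreteFourier.
Context {R : realType}.
Variable Q : nat.
Hypothesis Q0 : (0 < Q)%N.

Definition uroot : R[i] := cis (2 * pi / Q%:R).

Lemma urootQ : uroot ^+ Q = 1.
Proof.
rewrite /uroot cisX mulrCA divff ?mulr1 ?cis2pi //.
by rewrite pnatr_eq0 -lt0n.
Qed.

Lemma norm_uroot k : `|uroot ^+ k| = 1.
Proof. by rewrite normrX norm_cis expr1n. Qed.

(** Orthogonality of characters: the terms are the powers of a [Q]-th root of unity [a], and for
    [k != l] one has [a != 1], so the geometric sum vanishes. *)
Lemma uroot_sum (k l : 'I_Q) :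
  \sum_(j < Q) uroot ^+ (j * k) * (uroot ^+ (j * l))^* = Q%:R * (k == l)%:R.
Proof.
set a := uroot ^+ k * (uroot ^+ l)^*.
transitivity (\sum_(j < Q) a ^+ j).
  apply: eq_bigr => j _; rewrite /a exprMn -rmorphXn -!exprM.
  by rewrite ![(_ * j)%N]mulnC.
have [kl|kl] := eqVneq k l.
  have -> : a = 1 by rewrite /a kl -normCK norm_uroot expr1n.
  rewrite (eq_bigr (fun=> 1)) ?sumr_const ?card_ord ?mulr1 // => j _.
  by rewrite expr1n.
rewrite mulr0; apply/eqP.
have aQ : a ^+ Q = 1.
  by rewrite /a exprMn -rmorphXn !(exprAC _ _ Q) urootQ !expr1n mul1r rmorph1.
have /eqP : (a - 1) * \sum_(j < Q) a ^+ j = 0 by rewrite -subrX1 aQ subrr.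
rewrite mulf_eq0 => /orP[|//]; rewrite subr_eq0 => /eqP a1.
case/eqP: kl; apply: val_inj.
have Qr : 0 < Q%:R :> R by rewrite ltr0n.
have pi0 := pi_gt0 R.
set t : R := 2 * pi / Q%:R.
have t0 : 0 < t by rewrite divr_gt0 ?mulr_gt0.
have tQ : 2 * pi = Q%:R * t by rewrite /t [RHS]mulrC divfK // gt_eqF.
have kQ : k%:R < Q%:R :> R by rewrite ltr_nat.
have lQ : l%:R < Q%:R :> R by rewrite ltr_nat.
have k0 : 0 <= k%:R :> R by [].
have l0 : 0 <= l%:R :> R by [].
have /eqP : (k%:R - l%:R) * t = 0.
  apply: cis_eq1; first by rewrite tQ; apply/andP; split; nra.
  by rewrite mulrBl cisD -conj_cis -!cisX.
by rewrite mulf_eq0 (gt_eqF t0) orbF subr_eq0 eqr_nat => /eqP.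
Qed.

End DiscreteFourier.

(** * Von Neumann's inequality *)

(** Semidefinite, not definite: the defect form [B x y - B (T x) (T y)] of a contraction may vanish
    on nonzero vectors. The same notion covers the inner product of a Hilbert space and the product
    on R[i]. *)
Definition psd_form {R : realType} {V : lmodType R[i]} (D : V -> V -> R[i]) :=
  [/\ forall a x y z, D (a *: x + y) z = a * D x z + D y z,
      forall x y, D y x = (D x y)^* & forall x, 0 <= D x x].

Section PsdForm.
Context {R : realType} {V : lmodType R[i]} (D : V -> V -> R[i]).
Hypothesis psdD : psd_form D.

Lemma psd_suml (I : Type) (r : seq I) (a : I -> R[i]) (h : I -> V) y :
  D (\sum_(i <- r) a i *: h i) y = \sum_(i <- r) a i * D (h i) y.
Proof.
case: psdD => lin _ _; elim: r => [|i r IH]; last by rewrite !big_cons lin IH.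
rewrite !big_nil; have := lin (-1) 0 0 y.
by rewrite scaler0 addr0 mulN1r addNr.
Qed.

Lemma psd_sumr (I : Type) (r : seq I) (a : I -> R[i]) (h : I -> V) y :
  D y (\sum_(i <- r) a i *: h i) = \sum_(i <- r) (a i)^* * D y (h i).
Proof.
case: (psdD) => _ sym _; rewrite sym psd_suml rmorph_sum.
by apply: eq_bigr => i _; rewrite rmorphM /= -sym.
Qed.

Lemma psd_scale a x : D (a *: x) (a *: x) = `|a| ^+ 2 * D x x.
Proof.
have := psd_suml _ [:: tt] (fun=> a) (fun=> x).
have := psd_sumr _ [:: tt] (fun=> a) (fun=> x) x.
rewrite !big_seq1 => h1 /(_ (a *: x)); rewrite !big_seq1 => ->.
by rewrite h1 mulrA normCK.
Qed.

Section Parseval.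
Variable Q' : nat.
Notation Q := Q'.+1.
Notation w := (@uroot R Q).
Implicit Types h : 'I_Q -> V.

Let dft h (j : 'I_Q) := \sum_(l < Q) w ^+ (j * l) *: h l.

Lemma psd_parseval h :
  \sum_(j < Q) D (dft h j) (dft h j) = Q%:R * \sum_(l < Q) D (h l) (h l).
Proof.
transitivity (\sum_(j < Q) \sum_(l < Q) \sum_(k < Q)
    w ^+ (j * l) * (w ^+ (j * k))^* * D (h l) (h k)).
  apply: eq_bigr => j _; rewrite psd_suml; apply: eq_bigr => l _.
  by rewrite psd_sumr mulr_sumr; apply: eq_bigr => k _; rewrite mulrA.
rewrite exchange_big mulr_sumr; apply: eq_bigr => l _.
rewrite exchange_big (bigD1 l) //= -mulr_suml uroot_sum // eqxx mulr1.
rewrite big1 ?addr0 // => k kl.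
by rewrite -mulr_suml uroot_sum // eq_sym (negbTE kl) mulr0 mul0r.
Qed.

(* The discrete Fourier transform turns the cyclic correlation of h with the
   coefficients of p into multiplication by values of p on the circle. *)
Lemma psd_cyclic_correlation (p : {poly R[i]}) (M : R) h :
  (forall z, circle z -> `|p.[z]| <= M%:C) ->
  forall g, (forall n, g n = \sum_(i < size p) p`_i *: h (n + inZp i)%R) ->
  \sum_(n < Q) D (g n) (g n) <= (M ^+ 2)%:C * \sum_(l < Q) D (h l) (h l).
Proof.
move=> pM g gE; case: (psdD) => _ _ D0.
have Q0 : 0 < Q%:R :> R[i] by rewrite ltr0n.
(* A cyclic shift by [i] multiplies the [j]-th Fourier coefficient by the conjugate of
   [w ^+ (j * i)]. *)
have gh j : dft g j = p.[(w ^+ j)^*] *: dft h j.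
  rewrite /dft horner_coef scaler_suml.
  under eq_bigr do rewrite gE scaler_sumr.
  rewrite exchange_big; apply: eq_bigr => i _ /=.
  rewrite scaler_sumr [RHS](reindex_inj (addIr (inZp i : 'I_Q))) /=.
  apply: eq_bigr => n _; rewrite !scalerA; congr (_ *: _).
  have wmod k : w ^+ (k %% Q) = w ^+ k by exact/expr_mod/urootQ.
  rewrite !(mulnC j) !exprM wmod exprD wmod exprMn -rmorphXn /=.
  rewrite (exprAC w j i); set u := w ^+ i ^+ j.
  suff uu : u * u^* = 1.
    by rewrite mulrCA -!mulrA mulrCA (mulrC _ u) uu mulr1 mulrC.
  by rewrite -normCK /u -exprM norm_uroot expr1n.
rewrite -(ler_pM2l Q0) mulrCA -!psd_parseval mulr_sumr.
apply: ler_sum => j _; rewrite gh psd_scale ler_wpM2r //.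
rewrite (rmorphXn (real_complex R)) /= lerXn2r ?nnegrE //.
  by apply: le_trans (pM 1 _); rewrite /circle /= ?normr1 ?normr_ge0.
by apply: pM; rewrite /circle /= norm_conjC norm_uroot.
Qed.

End Parseval.

(** The cycle length [(K + size p).+1] is so large that [n + i] does not wrap around for [n < K] and
    [i < size p]; the other terms of the cyclic sum are dropped by positivity. *)
Lemma psd_correlation (p : {poly R[i]}) (M : R) (h : nat -> V) K :
  (forall z, circle z -> `|p.[z]| <= M%:C) ->
  forall g, (forall n, g n = \sum_(i < size p) p`_i *: h (n + i)%N) ->
  \sum_(n < K) D (g n) (g n) <=
  (M ^+ 2)%:C * \sum_(n < (K + size p).+1) D (h n) (h n).
Proof.
move=> pM g gE; case: (psdD) => _ _ D0.
set Q' := (K + size p)%N.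
have := psd_cyclic_correlation Q' p M (fun l => h (val l)) pM _ (fun=> erefl).
apply: le_trans; have KQ : (K <= Q'.+1)%N by rewrite leqW ?leq_addr.
rewrite (big_ord_widen _ (fun n => D (g n) (g n)) KQ) big_mkcond.
apply: ler_sum => n _; case: ifP => // nK.
suff -> : \sum_(i < size p) p`_i *: h (val (n + inZp i)) = g n by [].
rewrite gE; apply: eq_bigr => i _; congr (_ *: h _) => /=.
by rewrite modnDmr modn_small // ltnS leq_add // ltnW.
Qed.

End PsdForm.

(** Pointwise form of [poly_calc], over any module, so that it also applies to multiplication by a
    number on R[i]. *)
Definition pcalc {R : realType} {V : lmodType R[i]}
    (p : {poly R[i]}) (T : V -> V) (x : V) : V :=
  \sum_(i < size p) p`_i *: iter i T x.

Section VonNeumann.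
Context {R : realType} {V : lmodType R[i]} (B : V -> V -> R[i]).
Hypothesis psdB : psd_form B.

Lemma psd_defect (T : {linear V -> V}) :
  (forall x, B (T x) (T x) <= B x x) ->
  psd_form (fun x y => B x y - B (T x) (T y)).
Proof.
case: (psdB) => lin sym B0 hT; split=> [a x y z|x y|x]; last by rewrite subr_ge0.
  by rewrite linearP !lin mulrBr opprD addrACA.
by rewrite rmorphB /= -!sym.
Qed.

Lemma Re_psd x : (complex.Re (B x x))%:C = B x x.
Proof. by case: psdB => _ _ B0; apply/RRe_real/ger0_real. Qed.

(* With D x = B x x - B (T x) (T x), the sequence (D (T^n x))_n sums to B x x,
   and on such sequences p(T) acts as a correlation with the coefficients of p. *)
Lemma von_neumann_strict (T : {linear V -> V}) (p : {poly R[i]}) (M q : R) x :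
  (forall z, circle z -> `|p.[z]| <= M%:C) ->
  0 <= q -> q < 1 ->
  (forall x, B (T x) (T x) <= q%:C * B x x) ->
  complex.Re (B (pcalc p T x) (pcalc p T x)) <= M ^+ 2 * complex.Re (B x x).
Proof.
move=> pM q0 q1 hT; set px := pcalc p T x; case: (psdB) => lin sym B0.
have hT1 y : B (T y) (T y) <= B y y.
  by apply: le_trans (hT y) _; rewrite ler_piMl // -[1]/(1%:C) lecR ltW.
have Tn n : iter n T px = \sum_(i < size p) p`_i *: iter (n + i) T x.
  elim: n => [|n IH] //=; rewrite IH linear_sum.
  by apply: eq_bigr => i _; rewrite linearZ.
have tel y n : \sum_(k < n) (B (iter k T y) (iter k T y)
      - B (T (iter k T y)) (T (iter k T y))) = B y y - B (iter n T y) (iter n T y).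
  elim: n => [|n IH]; first by rewrite big_ord0 subrr.
  by rewrite big_ord_recr IH /=; ring.
pose b y := complex.Re (B y y).
have b0 y : 0 <= b y by rewrite -ler0c Re_psd.
have bn n : b (iter n T px) <= q ^+ n * b px.
  elim: n => [|n IH] /=; first by rewrite mul1r.
  apply: (@le_trans _ _ (q * b (iter n T px))).
    by have /Re_le := hT (iter n T px); rewrite Re_rM.
  by rewrite exprS -mulrA ler_wpM2l.
(* The defects of [px] over [n] steps sum to [b px - b (iter n T px)], and the correlation bound
   compares them with those of [x]. The term left over is at most [q ^+ n * b px], which tends to 0
   because [q < 1]. *)
have main n : b px <= M ^+ 2 * b x + q ^+ n * b px.
  have := psd_correlation _ (psd_defect T hT1) p M (fun k => iter k T x) n pM _ Tn.
  rewrite !tel => /Re_le; rewrite Re_rM !raddfB /= -/(b _) -/(b _) -/(b _) => h.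
  rewrite -lerBlDr; apply: le_trans (_ : _ <= b px - b (iter n T px)) _.
    by rewrite lerD2l lerN2.
  apply: le_trans h _; rewrite ler_wpM2l ?sqr_ge0 //.
  by rewrite lerBlDr lerDl b0.
have qcvg : geometric (b px) q n @[n --> \oo] --> (0 : R).
  by apply: cvg_geometric; rewrite ger0_norm.
rewrite -subr_le0; apply: (cvgr_to_ge qcvg); apply: nearW => n.
by rewrite /= lerBlDl (mulrC (b px)).
Qed.

Lemma iter_scale (T : {linear V -> V}) (a : R[i]) i x :
  iter i (a \*: T) x = a ^+ i *: iter i T x.
Proof.
elim: i => [|i IH] /=; first by rewrite scale1r.
by rewrite IH /= linearZ scalerA -exprS.
Qed.

(** The strict case applies to [r T] with [r < 1]. As [V] carries no topology, the passage to
    [r = 1] uses that the form at [p (r T) x] is a polynomial [q] in the real number [r]. *)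
Lemma von_neumann_form (T : {linear V -> V}) (p : {poly R[i]}) (M : R) x :
  (forall z, circle z -> `|p.[z]| <= M%:C) ->
  (forall x, B (T x) (T x) <= B x x) ->
  complex.Re (B (pcalc p T x) (pcalc p T x)) <= M ^+ 2 * complex.Re (B x x).
Proof.
move=> pM hT; pose v i := p`_i *: iter i T x.
pose c i k := complex.Re (B (v i) (v k)).
pose q : {poly R} := \sum_(i < size p) \sum_(k < size p) (c i k) *: 'X^(i + k).
have qE r : complex.Re (B (pcalc p (r%:C \*: T) x) (pcalc p (r%:C \*: T) x)) = q.[r].
  have -> : pcalc p (r%:C \*: T) x = \sum_(i < size p) (r ^+ i)%:C *: v i.
    apply: eq_bigr => i _; rewrite iter_scale /v !scalerA mulrC.
    by rewrite (rmorphXn (real_complex R)).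
  rewrite psd_suml // horner_sum Re_sum; apply: eq_bigr => i _.
  rewrite psd_sumr // Re_rM Re_sum horner_sum mulr_sumr.
  apply: eq_bigr => k _; rewrite hornerZ hornerXn /c.
  by rewrite conj_Creal ?complex_real // Re_rM exprD; ring.
have -> : complex.Re (B (pcalc p T x) (pcalc p T x)) = q.[1].
  rewrite -qE; suff -> : pcalc p (1%:C \*: T) x = pcalc p T x by [].
  by apply: eq_bigr => i _; rewrite iter_scale expr1n scale1r.
have qcvg : q.[r] @[r --> 1^'-] --> q.[1].
  exact/cvg_at_left_filter/continuous_horner.
apply: (cvgr_to_le qcvg).
near=> r; rewrite -qE.
have r0 : 0 <= r by near: r; apply: nbhs_left_ge; exact: ltr01.
have r1 : r < 1 by near: r; exact: nbhs_left_lt.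
apply: (@von_neumann_strict (r%:C \*: T) p M (r ^+ 2)) => //.
- exact: sqr_ge0.
- by rewrite expr_lt1.
move=> y /=; rewrite psd_scale // -normrX ger0_norm ?(rmorphXn (real_complex R)) /=.
  by rewrite ler_wpM2l // -(rmorphXn (real_complex R)) ler0c sqr_ge0.
by rewrite -(rmorphXn (real_complex R)) ler0c sqr_ge0.
Unshelve. all: by end_near.
Qed.

End VonNeumann.

Section Applications.
Context {R : realType}.

Lemma von_neumann {H : hilbertType R} (T : {linear H -> H}) p (M : R) :
  (forall x, rnorm (T x) <= rnorm x) ->
  (forall z, circle z -> rnorm p.[z] <= M) ->
  forall x, rnorm (pcalc p T x) <= M * rnorm x.
Proof.
move=> hT hp x; have M0 : 0 <= M.
  by apply: le_trans (rnorm_ge0 _ p.[1]) (hp _ _); rewrite /circle /= normr1.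
have psd : psd_form (fun x y : H => inner x y).
  split=> [a y z t|y z|y].
  - by rewrite linearPl.
  - by rewrite hermC expr0 mul1r.
  - by rewrite inner_normE exprn_ge0.
have Bn (y : H) : complex.Re (inner y y) = rnorm y ^+ 2.
  by rewrite inner_normE -rnormE -(rmorphXn (real_complex R)).
have := @von_neumann_form _ _ _ psd T p M x; rewrite !Bn -exprMn.
rewrite ler_pXn2r ?nnegrE ?mulr_ge0 ?rnorm_ge0 //; apply.
- by move=> z hz; rewrite -rnormE lecR hp.
- move=> y; rewrite !inner_normE -!rnormE lerXn2r ?nnegrE ?ler0c ?rnorm_ge0 //.
  by rewrite lecR hT.
Qed.

(** Von Neumann's inequality for multiplication by [w], a contraction of the one-dimensional space
    R[i], evaluated at the vector 1. *)
Lemma max_modulus (p : {poly R[i]}) (M : R) w :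
  (forall z, circle z -> rnorm p.[z] <= M) ->
  rnorm w <= 1 -> rnorm p.[w] <= M.
Proof.
move=> hp hw; have M0 : 0 <= M.
  by apply: le_trans (rnorm_ge0 _ p.[1]) (hp _ _); rewrite /circle /= normr1.
have psd : psd_form (fun x y : R[i]^o => (x : R[i]) * Num.conj (y : R[i])).
  split=> [a y z t|y z|y].
  - by rewrite mulrDl mulrA.
  - by rewrite rmorphM /= conjCK mulrC.
  - by rewrite -normCK exprn_ge0.
have Bn (y : R[i]) : complex.Re (y * Num.conj y) = rnorm y ^+ 2.
  by rewrite -normCK -rnormE -(rmorphXn (real_complex R)).
have := @von_neumann_form _ R[i]^o _ psd (w \*: idfun) p M 1.
have -> : pcalc p (w \*: idfun) (1 : R[i]^o) = p.[w].
  rewrite horner_coef; apply: eq_bigr => i _; rewrite iter_scale.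
  suff -> : iter i idfun (1 : R[i]^o) = 1 by rewrite scalerA /GRing.scale /= mulr1.
  by elim: (nat_of_ord i) => //= n ->.
rewrite !Bn -exprMn rnorm1 mulr1 ler_pXn2r ?nnegrE ?rnorm_ge0 //; apply.
- by move=> z hz; rewrite -rnormE lecR hp.
- move=> y /=; rewrite -!normCK lerXn2r ?nnegrE // normrM ler_piMl //.
  by rewrite -rnormE -[1]/(1%:C) lecR.
Qed.

End Applications.

(** * Bernstein inequality for operators *)

Section PolynomialCalculus.
Context {R : realType} {V : lmodType R[i]}.
Implicit Types (T : V -> V) (p q : {poly R[i]}).

Lemma pcalc_wide p T x N : (size p <= N)%N ->
  pcalc p T x = \sum_(i < N) p`_i *: iter i T x.
Proof.
move=> pN; rewrite /pcalc (big_ord_widen _ (fun i => p`_i *: iter i T x) pN).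
rewrite big_mkcond; apply: eq_bigr => i _; case: ltnP => // h.
by rewrite nth_default ?scale0r.
Qed.

Lemma pcalcB p q T x : pcalc (p - q) T x = pcalc p T x - pcalc q T x.
Proof.
set N := maxn (size p) (size q).
have hpq : (size (p - q)%R <= N)%N by rewrite (leq_trans (size_polyD _ _)) // size_polyN.
rewrite !(@pcalc_wide _ _ _ N) ?leq_maxl ?leq_maxr //.
by rewrite -sumrB; apply: eq_bigr => i _; rewrite coefB scalerBl.
Qed.

Section Perturbation.
Variables (T D : {linear V -> V}) (x : V).

(* [pert_coef i j] is the coefficient of s^j in (T + s D)^i x. *)
Fixpoint pert_coef (i j : nat) : V :=
  if i is i'.+1 then
    T (pert_coef i' j) + (if j is j'.+1 then D (pert_coef i' j') else 0)
  else if j == 0%N then x else 0.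

Lemma pert_coef_gt i j : (i < j)%N -> pert_coef i j = 0.
Proof.
elim: i j => [|i IH] [|j] //= ij.
by rewrite !IH ?linear0 ?addr0 // ltnW.
Qed.

Lemma iter_pert i s :
  iter i (T \+ s \*: D) x = \sum_(j < i.+1) s ^+ j *: pert_coef i j.
Proof.
elim: i => [|i IH] /=; first by rewrite big_ord_recl big_ord0 scale1r addr0.
rewrite IH; under eq_bigr do rewrite scalerDr.
rewrite big_split /= [in RHS]big_ord_recr /= pert_coef_gt // linear0 scaler0 addr0.
rewrite [X in _ = _ + X]big_ord_recl /= scaler0 add0r !linear_sum.
congr (_ + _); apply: eq_bigr => j _; first by rewrite linearZ.
by rewrite /= linearZ /= scalerA -exprS.
Qed.

Definition pcalc_pert_coef p j := \sum_(i < size p) p`_i *: pert_coef i j.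

Lemma pcalc_pert p s N : (size p <= N)%N ->
  pcalc p (T \+ s \*: D) x = \sum_(j < N) s ^+ j *: pcalc_pert_coef p j.
Proof.
move=> pN; rewrite /pcalc /pcalc_pert_coef.
under [RHS]eq_bigr do rewrite scaler_sumr.
rewrite exchange_big; apply: eq_bigr => i _ /=; rewrite iter_pert.
rewrite (big_ord_widen N (fun j => s ^+ j *: pert_coef i j)); last first.
  exact: leq_trans (ltn_ord i) pN.
rewrite big_mkcond scaler_sumr; apply: eq_bigr => j _; case: ltnP => h.
  by rewrite !scalerA mulrC.
by rewrite pert_coef_gt ?scaler0.
Qed.

End Perturbation.
End PolynomialCalculus.

Section Bernstein.
Context {R : realType}.
Implicit Types p : {poly R[i]}.

(** The contour integral becomes an average over the [N]-th roots of unity, which isolates each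
    coefficient exactly because there are only [N] of them. This avoids integrating vector-valued
    functions. *)
Lemma cauchy_coef {V : normedModType R[i]} (G : nat -> V) N (rho M : R) :
  0 <= rho ->
  (forall s, rnorm s = rho -> rnorm (\sum_(j < N) s ^+ j *: G j) <= M) ->
  forall j, (j < N)%N -> rho ^+ j * rnorm (G j) <= M.
Proof.
move=> rho0 hM j jN; case: N => // N in hM jN *; set Q := N.+1.
have Q0 : 0 < Q%:R :> R by rewrite ltr0n.
pose w := @uroot R Q; pose g s := \sum_(j < Q) s ^+ j *: G j.
have E : Q%:R *: (rho%:C ^+ j *: G j) =
    \sum_(l < Q) (w ^+ (l * j))^* *: g (rho%:C * w ^+ l).
  under eq_bigr do rewrite scaler_sumr.
  rewrite exchange_big (bigD1 (Ordinal jN)) //= [X in _ + X]big1 ?addr0 => [|k kj].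
    rewrite scalerA; under eq_bigr do rewrite scalerA.
    rewrite -scaler_suml; congr (_ *: _).
    have := @uroot_sum R Q isT (Ordinal jN) (Ordinal jN); rewrite eqxx mulr1 => <-.
    by rewrite mulr_suml; apply: eq_bigr => l _ /=; rewrite exprMn -exprM -/w; ring.
  under eq_bigr do rewrite scalerA.
  rewrite -scaler_suml [X in X *: _](_ : _ = 0) ?scale0r //.
  have := @uroot_sum R Q isT k (Ordinal jN); rewrite (negbTE kj) mulr0.
  move/(congr1 ( *%R (rho%:C ^+ k))); rewrite mulr0 => h; rewrite -[RHS]h mulr_sumr.
  by apply: eq_bigr => l _ /=; rewrite exprMn -exprM -/w; ring.
rewrite -(ler_pM2l Q0).
have -> : Q%:R * (rho ^+ j * rnorm (G j)) = rnorm (Q%:R *: (rho%:C ^+ j *: G j)).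
  rewrite !rnormZ rnormX rnormR ger0_norm //; congr (_ * _).
  by rewrite -(rmorph_nat (real_complex R)) rnormR ger0_norm.
rewrite E (le_trans (rnorm_sum _ _ _ _ _)) //.
apply: le_trans (_ : \sum_(l < Q) M <= _); last first.
  by rewrite sumr_const card_ord mulr_natl.
have nw l : rnorm (w ^+ l) = 1 by rewrite /rnorm norm_uroot.
apply: ler_sum => l _; rewrite rnormZ rnorm_conj nw mul1r.
by apply: hM; rewrite rnormM nw mulr1 rnormR ger0_norm.
Qed.

(* Maximum principle for the reversed polynomial. *)
Lemma growth_bound p N (M r : R) z :
  (size p <= N)%N -> (forall z, circle z -> rnorm p.[z] <= M) ->
  1 <= r -> rnorm z = r -> rnorm p.[z] <= r ^+ N * M.
Proof.
have c1 : circle (1 : R[i]) by rewrite /circle /= normr1.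
move=> pN pM r1 zr; have M0 : 0 <= M by exact: le_trans (rnorm_ge0 _ _) (pM 1 c1).
case: N pN => [|N] pN.
  by move: pN; rewrite mul1r leqn0 size_poly_eq0 => /eqP ->; rewrite horner0 rnorm0.
pose q := \poly_(i < N.+1) p`_(N - i).
have qE y : y != 0 -> p.[y] = y ^+ N * q.[y^-1].
  move=> y0; rewrite (horner_coef_wide _ pN) horner_poly mulr_sumr.
  rewrite (reindex_inj rev_ord_inj); apply: eq_bigr => i _ /=.
  rewrite subSS mulrCA; congr (_ * _); rewrite exprVn.
  by rewrite expfB_cond // (negbTE y0) add0n -ltnS.
have z0 : z != 0.
  by apply/eqP => z0; move: r1; rewrite -zr z0 rnorm0 ler10.
rewrite qE // rnormM rnormX zr; apply: ler_pM; rewrite ?rnorm_ge0 //.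
  by rewrite exprn_ge0 // (le_trans ler01).
  by rewrite ler_weXn2l.
apply: max_modulus => [y hy|].
  have y0 : y != 0 by rewrite -normr_eq0 hy oner_neq0.
  have := pM y^-1; rewrite qE ?invr_eq0 // invrK rnormM rnormX.
  have -> : rnorm y^-1 = 1 by rewrite /rnorm normfV hy invr1.
  by rewrite expr1n mul1r; apply; rewrite /circle /= normfV hy invr1.
have : rnorm z * rnorm z^-1 = 1 by rewrite -rnormM divff // rnorm1.
by rewrite zr => h; rewrite -[leRHS]h ler_peMl // rnorm_ge0.
Qed.

(** With [q z = p (r z)] one has [p (T) = q (T / r)]; here [T / r] is a contraction, and
    [growth_bound] controls [q] on the circle. *)
Lemma von_neumann_radius {H : hilbertType R} (T : {linear H -> H}) p N (M r : R) :
  (size p <= N)%N -> (forall z, circle z -> rnorm p.[z] <= M) ->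
  1 <= r -> (forall x, rnorm (T x) <= r * rnorm x) ->
  forall x, rnorm (pcalc p T x) <= r ^+ N * M * rnorm x.
Proof.
move=> pN pM r1 hT x; have r0 : 0 < r by apply: lt_le_trans r1.
have rc : r%:C != 0 by rewrite (fmorph_eq0 (real_complex R)) gt_eqF.
pose q := \poly_(i < N) (p`_i * r%:C ^+ i).
have -> : pcalc p T x = pcalc q (r%:C^-1 \*: T) x.
  rewrite (pcalc_wide _ _ _ _ pN) (pcalc_wide q _ _ N) ?size_poly //.
  apply: eq_bigr => i _; rewrite coef_poly ltn_ord iter_scale scalerA.
  by rewrite exprVn -mulrA divff ?mulr1 // expf_neq0.
apply: von_neumann => [y|z hz].
  rewrite /= rnormZ -(fmorphV (real_complex R)) rnormR ger0_norm ?invr_ge0 ?(ltW r0) //.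
  by rewrite ler_pdivrMl.
have -> : q.[z] = p.[r%:C * z].
  rewrite horner_poly (horner_coef_wide _ pN); apply: eq_bigr => i _.
  by rewrite exprMn mulrA.
apply: (growth_bound _ N _ r) => //.
by rewrite rnormM rnormR ger0_norm ?(ltW r0) // /rnorm hz mulr1.
Qed.

(** Differences of order [m] annihilate polynomials of degree below [m]. In the induction, one
    factor [k] is absorbed into the binomial coefficient, which lowers both the order and the degree
    by one; expanding [k.+1 ^ j] then leaves only lower cases. *)
Lemma fin_diff_pow m j : (j < m)%N ->
  \sum_(k < m.+1) (-1) ^+ k * 'C(m, k)%:R * k%:R ^+ j = 0 :> R[i].
Proof.
elim: m j => // m IH [|j] jm.
  transitivity ((1 - 1 : R[i]) ^+ m.+1); last by rewrite subrr expr0n.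
  rewrite exprBn; apply: eq_bigr => k _.
  by rewrite !expr1n !mulr1 mulr_natr.
rewrite big_ord_recl /= expr0n mulr0 add0r.
transitivity (- m.+1%:R * \sum_(i < j.+1) ('C(j, i)%:R *
   \sum_(k < m.+1) (-1) ^+ k * 'C(m, k)%:R * k%:R ^+ i) : R[i]).
  under [X in _ * X]eq_bigr do rewrite mulr_sumr.
  rewrite exchange_big mulr_sumr; apply: eq_bigr => k _.
  rewrite /bump /= add1n.
  have e : m.+1%:R * 'C(m, k)%:R = k.+1%:R * 'C(m.+1, k.+1)%:R :> R[i].
    by rewrite -!natrM mul_bin_diag.
  have -> : \sum_(i < j.+1) 'C(j, i)%:R * ((-1) ^+ k * 'C(m, k)%:R * k%:R ^+ i)
     = (-1) ^+ k * 'C(m, k)%:R * k.+1%:R ^+ j :> R[i].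
    rewrite [in RHS]mulrSr exprD1n mulr_sumr; apply: eq_bigr => i _.
    by rewrite -[X in _ = _ * X]mulr_natl [RHS]mulrCA.
  transitivity (- (-1) ^+ k * (k.+1%:R * 'C(m.+1, k.+1)%:R) * k.+1%:R ^+ j : R[i]).
    by rewrite (exprS _ k) (exprS _ j); ring.
  by rewrite -e; ring.
by rewrite big1 ?mulr0 // => i _; rewrite IH ?mulr0 // (leq_trans (ltn_ord i)).
Qed.

(** The sign is that of the sum in the theorem; it differs by [(-1) ^+ m] from the [m]-th power of a
    difference operator, see [iter_DeltaE]. *)
Definition fin_diff {V : lmodType R[i]} (m : nat) (g : nat -> V) : V :=
  \sum_(k < m.+1) ((-1) ^+ k * 'C(m, k)%:R : R[i]) *: g k.

Lemma rnorm_fin_diff {V : normedModType R[i]} m (g : nat -> V) (M : R) :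
  (forall k, (k <= m)%N -> rnorm (g k) <= M) ->
  rnorm (fin_diff m g) <= 2 ^+ m * M.
Proof.
move=> hg; rewrite (le_trans (rnorm_sum _ _ _ _ _)) //.
rewrite -[2 ^+ m]natrX -[(2 ^ m)%N]/((1 + 1) ^ m)%N expnDn natr_sum mulr_suml.
apply: ler_sum => k _; rewrite rnormZ rnormM rnormX rnormN rnorm1 expr1n mul1r.
rewrite !exp1n !muln1 -(rmorph_nat (real_complex R)) rnormR ger0_norm //.
by rewrite ler_wpM2l // hg // -ltnS.
Qed.

Lemma operator_bernstein {H : hilbertType R} (T D : {linear H -> H}) p m N
    (M delta : R) :
  (0 < m)%N -> (0 < N)%N -> (size p <= N)%N ->
  (forall z, circle z -> rnorm p.[z] <= M) ->
  (forall x, rnorm (T x) <= rnorm x) ->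
  (forall x, rnorm (D x) <= delta * rnorm x) ->
  0 < delta -> N%:R * delta <= 1 / 2 ->
  forall x, rnorm (fin_diff m (fun k => pcalc p (T \+ (k%:R / m%:R) \*: D) x)) <=
    expR 1 * 2 ^+ m.+1 * (N%:R * delta) ^+ m * M * rnorm x.
Proof.
move=> m0 N0 pN pM hT hD d0 Nd x.
have M0 : 0 <= M.
  by apply: le_trans (rnorm_ge0 _ p.[1]) (pM _ _); rewrite /circle /= normr1.
have Nr : 0 < N%:R :> R by rewrite ltr0n.
set a := N%:R * delta; have a0 : 0 < a by rewrite mulr_gt0.
pose G := pcalc_pert_coef T D x p.
pose M' := expR 1 * M * rnorm x.
have M'0 : 0 <= M' by rewrite !mulr_ge0 ?expR_ge0 ?rnorm_ge0.
have GE s : pcalc p (T \+ s \*: D) x = \sum_(j < N) s ^+ j *: G j by exact: pcalc_pert.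
(* The radius is [a^-1 = 1 / (N * delta)]: there [s D] has norm at most [1 / N], and
   [(1 + 1 / N) ^+ N <= expR 1]. *)
have Gj j : (j < N)%N -> rnorm (G j) <= a ^+ j * M'.
  move=> jN; rewrite -(ler_pM2l (exprn_gt0 j (_ : 0 < a^-1))) ?invr_gt0 //.
  rewrite mulrA -exprMn mulVf ?gt_eqF // expr1n mul1r.
  apply: (@cauchy_coef _ _ N) => //; first by rewrite invr_ge0 ltW.
  move=> s hs; rewrite -GE.
  have := @von_neumann_radius _ (T \+ s \*: D) p N M (1 + N%:R^-1) pN pM _ _ x.
  move=> /(_ _ _)/le_trans; apply.
  - by rewrite lerDl invr_ge0.
  - move=> y /=; rewrite (le_trans (rnormD_le _ _ _)) // mulrDl mul1r lerD //.
    rewrite rnormZ hs (le_trans (ler_wpM2l _ (hD y))) ?invr_ge0 ?(ltW a0) //.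
    by rewrite mulrA /a invfM -(mulrA _ _ delta) mulVf ?gt_eqF // mulr1.
  - rewrite /M' -!mulrA ler_wpM2r ?mulr_ge0 ?rnorm_ge0 //.
    have -> : expR 1 = expR (N%:R^-1) ^+ N :> R.
      by rewrite -expRM_natl divff ?gt_eqF.
    by rewrite lerXn2r ?nnegrE ?expR_ge0 ?addr_ge0 ?invr_ge0 // expR_ge1Dx.
(* [c j] is the factor that the difference puts in front of the coefficient [G j]. Its vanishing for
   [j < m] starts the sum at [j = m], whence the factor [a ^+ m]. *)
pose c j : R[i] := \sum_(k < m.+1) (-1) ^+ k * 'C(m, k)%:R * (k%:R / m%:R) ^+ j.
have cm j : (j < m)%N -> c j = 0.
  move=> jm; rewrite /c (eq_bigr (fun k : 'I_m.+1 => ((-1) ^+ k * 'C(m, k)%:R *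
      k%:R ^+ j) * m%:R ^- j)).
    by rewrite -mulr_suml fin_diff_pow // mul0r.
  by move=> k _; rewrite exprMn exprVn mulrA.
have cb j : rnorm (c j) <= 2 ^+ m.
  rewrite -[2 ^+ m]mulr1; apply: (@rnorm_fin_diff R[i]^o m (fun k => (k%:R / m%:R) ^+ j) 1).
  move=> k km; rewrite rnormX -!(rmorph_nat (real_complex R)).
  rewrite -(fmorphV (real_complex R)) -(rmorphM (real_complex R)) rnormR.
  rewrite ger0_norm ?divr_ge0 // exprn_ile1 ?divr_ge0 //.
  by rewrite ler_pdivrMr ?ltr0n // mul1r ler_nat.
have -> : fin_diff m (fun k => pcalc p (T \+ (k%:R / m%:R) \*: D) x) =
    \sum_(j < N) c j *: G j.
  rewrite /fin_diff; under eq_bigr do rewrite GE scaler_sumr.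
  rewrite exchange_big; apply: eq_bigr => j _; rewrite /c scaler_suml.
  by apply: eq_bigr => k _; rewrite scalerA.
rewrite (le_trans (rnorm_sum _ _ _ _ _)) //.
have -> : expR 1 * 2 ^+ m.+1 * a ^+ m * M * rnorm x = 2 ^+ m * a ^+ m * M' * 2.
  by rewrite /M' exprS; ring.
(* By [a <= 1 / 2] the geometric series is at most 2, which turns [2 ^+ m] into [2 ^+ m.+1]. *)
have geo n : \sum_(j < n) a ^+ j <= 2.
  elim: n => [|n IH]; first by rewrite big_ord0.
  rewrite big_ord_recl expr0.
  apply: le_trans (_ : 1 + a * \sum_(j < n) a ^+ j <= _).
    by rewrite lerD2l mulr_sumr; apply: ler_sum => i _; rewrite /= /bump add1n exprS.
  have : a * \sum_(j < n) a ^+ j <= a * 2 by rewrite ler_wpM2l // ltW.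
  by rewrite /a in Nd *; lra.
have K0 : 0 <= 2 ^+ m * a ^+ m * M'.
  by rewrite mulr_ge0 // mulr_ge0 // exprn_ge0 // ltW.
apply: le_trans (_ : \sum_(j < N) 2 ^+ m * a ^+ m * M' * a ^+ j <= _); last first.
  by rewrite -mulr_sumr ler_wpM2l.
rewrite (bigID (fun j : 'I_N => m <= j)%N) /= [X in _ + X]big1 ?addr0; last first.
  by move=> j; rewrite -ltnNge => jm; rewrite cm // scale0r rnorm0.
rewrite -(big_geq_mkord m N predT (fun j => rnorm (c j *: G j))).
rewrite -{1}[m]add0n big_addn big_mkord.
rewrite (big_ord_widen N (fun j => rnorm (c (j + m)%N *: G (j + m)%N)) (leq_subr m N)).
rewrite big_mkcond; apply: ler_sum => j _; case: ifP => jN; last first.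
  by rewrite mulr_ge0 // exprn_ge0 // ltW.
have -> : 2 ^+ m * a ^+ m * M' * a ^+ j = 2 ^+ m * (a ^+ (j + m) * M').
  by rewrite exprD; ring.
by rewrite rnormZ ler_pM ?rnorm_ge0 // Gj // addnC -ltn_subRL.
Qed.
End Bernstein.

(** * Means over the circle *)

Section RealIntegral.
Context {R : realType}.
Implicit Types h F : R -> R.
Local Notation mu := (@lebesgue_measure R).

Lemma continuous_integrable h (a b : R) :
  continuous h -> mu.-integrable `[a, b] (EFin \o h).
Proof.
move=> ch; apply: continuous_compact_integrable; first exact: segment_compact.
exact: continuous_subspaceT.
Qed.

Lemma Rintegral_FTC2 h F (a b : R) : a < b -> continuous h ->
  (forall x, a <= x <= b -> is_derive x 1 F (h x)) ->
  Rintegral mu `[a, b] h = F b - F a.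
Proof.
move=> ab ch dF.
have cF x : a <= x <= b -> {for x, continuous F}.
  move=> xab; apply/differentiable_continuous/derivable1_diffP.
  by have [] := dF x xab.
rewrite /Rintegral (@continuous_FTC2 _ h F) //.
- exact: continuous_subspaceT.
- split.
  + move=> x; rewrite in_itv /= => /andP[ax xb].
    by have [|] := dF x; first by rewrite !ltW.
  + by apply/cvg_at_right_filter/cF; rewrite lexx ltW.
  + by apply/cvg_at_left_filter/cF; rewrite lexx ltW.
- move=> x; rewrite in_itv /= => /andP[ax xb].
  by have [|_ <-] := dF x; [rewrite !ltW|rewrite derive1E].
Qed.

Lemma antiderivative_gt h (L : R) : continuous h ->
  exists F, forall x, L < x -> is_derive x 1 F (h x).
Proof.
move=> ch; exists (fun x => Rintegral mu `[L, x] h) => x Lx.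
have xx : x < x + 1 by rewrite ltrDl.
have [d1 d2] := continuous_FTC1_closed xx (continuous_integrable h L (x + 1) ch) Lx (ch x).
by split; rewrite -?derive1E.
Qed.

Lemma is_deriveZ_id (k t : R) : is_derive t 1 ( *%R k) k.
Proof.
have -> : *%R k = k \*: (@idfun R) by apply/funext.
by apply: is_derive_eq; rewrite /GRing.scale /= mulr1.
Qed.

Lemma Rintegral_periodic_affine h (c a : R) (k : nat) :
  0 < c -> (0 < k)%N -> continuous h -> (forall x, h (x + c) = h x) ->
  Rintegral mu `[0, c] (fun t : R => h (k%:R * t + a)) = Rintegral mu `[0, c] h.
Proof.
move=> c0 k0 ch hc; pose L : R := - `|a| - 1.
have L0 : L < 0 by rewrite /L; have := normr_ge0 a; lra.
have La : L < a by rewrite /L; have := ler_norm (- a); rewrite normrN; lra.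
(* [F] is an antiderivative only to the right of [L]; as [L] is below both 0 and [a], this covers
   [t] and [k t + a] for all [t >= 0]. *)
have [F dF] := antiderivative_gt h L ch.
have kr : 0 < k%:R :> R by rewrite ltr0n.
have step (x : R) : 0 < x - L -> F (x + c) - F x = F (L / 2 + c) - F (L / 2).
  move=> xL; pose G t := F (t + c) - F t.
  have dG (t : R) : L < t -> is_derive t 1 G 0.
    move=> Lt; have d1 := dF _ Lt.
    have d2 : is_derive t 1 (fun t : R => F (t + c)) (h t).
      have Ltc : L < t + c by lra.
      have := dF _ Ltc; rewrite hc => d3.
      have d4 : is_derive t 1 (fun t : R => t + c) 1.
        by rewrite -[X in is_derive _ _ _ X]addr0; apply: is_deriveD.
      have := @is_derive1_comp _ F (fun t : R => t + c) t (h t) 1 d3 d4.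
      by rewrite mulr1.
    by rewrite -(subrr (h t)); apply: is_deriveB.
  have Gc (u v : R) : L < u -> u < v -> G v = G u.
    move=> Lu uv; have dG' (t : R) : u <= t <= v -> is_derive t 1 G 0.
      by move=> /andP[ut _]; apply: dG; apply: lt_le_trans ut.
    have := Rintegral_FTC2 _ _ _ _ uv (@cst_continuous _ _ (0 : R)) dG'.
    by rewrite Rintegral_cst // mul0r => /esym/subr0_eq.
  have L2 : L < L / 2 by lra.
  have [xl|xl|->//] := ltgtP x (L / 2).
  - by symmetry; apply: Gc => //; lra.
  - by apply: Gc.
have stepn n (x : R) : L < x -> F (x + n%:R * c) - F x = n%:R * (F c - F 0).
  move=> Lx; elim: n => [|n IH]; first by rewrite !mul0r addr0 subrr.
  have nc : 0 <= n%:R * c by rewrite mulr_ge0 // ltW.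
  have e0 : F c - F 0 = F (L / 2 + c) - F (L / 2).
    by rewrite -(step 0) ?add0r //; lra.
  have e1 : F (x + n%:R * c + c) - F (x + n%:R * c) = F c - F 0.
    by rewrite e0; apply: step; lra.
  have -> : x + n.+1%:R * c = x + n%:R * c + c by rewrite mulrSr; ring.
  by rewrite mulrSr mulrDl mul1r -IH -e1; ring.
have dF0 (x : R) : 0 <= x <= c -> is_derive x 1 F (h x).
  by move=> /andP[x0 _]; apply: dF; lra.
rewrite (Rintegral_FTC2 _ _ _ _ c0 ch dF0).
pose G t := F (k%:R * t + a) / k%:R.
have dG (t : R) : 0 <= t <= c -> is_derive t 1 G (h (k%:R * t + a)).
  move=> /andP[t0 _]; have Lt : L < k%:R * t + a.
    by have : 0 <= k%:R * t by [rewrite mulr_ge0 // ltW]; lra.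
  have d1 := dF _ Lt.
  have d4 : is_derive t 1 (fun t : R => k%:R * t + a) k%:R.
    rewrite -[X in is_derive _ _ _ X]addr0; apply: is_deriveD.
    exact: is_deriveZ_id.
  have d5 := @is_derive1_comp _ F _ t _ _ d1 d4.
  have -> : G = (k%:R^-1 : R) \*: (F \o (fun t : R => k%:R * t + a)).
    by apply/funext => u /=; rewrite /G mulrC.
  apply: (is_derive_eq (is_deriveZ _ d5)).
  by rewrite /GRing.scale /= mulrCA mulVf ?gt_eqF // mulr1.
have cG : continuous (fun t : R => h (k%:R * t + a)).
  move=> t; apply: continuous_comp; last exact: ch.
  by apply: cvgD; [apply: cvgM; [exact: cvg_cst|exact: cvg_id]|exact: cvg_cst].
rewrite (Rintegral_FTC2 _ _ _ _ c0 cG dG) /G mulr0 add0r -mulrBl addrC.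
rewrite [k%:R * c + a]addrC [X in X / _](addrC (- _)) stepn //.
by rewrite mulrAC divff ?mul1r ?gt_eqF.
Qed.

End RealIntegral.

Section CircleMean.
Context {R : realType}.
Implicit Types g : R -> R[i].
Local Notation mu := (@lebesgue_measure R).

(** Continuity by components matches [cintegral], which integrates the real and imaginary parts
    separately. *)
Definition ccontinuous g :=
  continuous (fun t => complex.Re (g t)) /\ continuous (fun t => complex.Im (g t)).

Definition cmean g : R[i] := (2 * pi)%:C^-1 * cintegral 0 (2 * pi) g.

Lemma ccontinuous_cst (a : R[i]) : ccontinuous (fun=> a).
Proof. by split; exact: cst_continuous. Qed.

Lemma ccontinuousD g1 g2 : ccontinuous g1 -> ccontinuous g2 ->
  ccontinuous (fun t => g1 t + g2 t).
Proof.
move=> [r1 i1] [r2 i2]; split=> t.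
  under eq_fun do rewrite raddfD; exact: cvgD (r1 t) (r2 t).
under eq_fun do rewrite raddfD; exact: cvgD (i1 t) (i2 t).
Qed.

Lemma ReB (a b : R[i]) : complex.Re (a - b) = complex.Re a - complex.Re b.
Proof. by case: a b => ? ? [? ?]. Qed.

Lemma ImB (a b : R[i]) : complex.Im (a - b) = complex.Im a - complex.Im b.
Proof. by case: a b => ? ? [? ?]. Qed.

Lemma ReM (a b : R[i]) : complex.Re (a * b) =
  complex.Re a * complex.Re b - complex.Im a * complex.Im b.
Proof. by case: a b => ? ? [? ?]. Qed.

Lemma ImM (a b : R[i]) : complex.Im (a * b) =
  complex.Re a * complex.Im b + complex.Im a * complex.Re b.
Proof. by case: a b => ? ? [? ?]. Qed.

Lemma ccontinuousM g1 g2 : ccontinuous g1 -> ccontinuous g2 ->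
  ccontinuous (fun t => g1 t * g2 t).
Proof.
move=> [r1 i1] [r2 i2]; split=> t.
  under eq_fun do rewrite ReM.
  exact: cvgB (cvgM (r1 t) (r2 t)) (cvgM (i1 t) (i2 t)).
under eq_fun do rewrite ImM.
exact: cvgD (cvgM (r1 t) (i2 t)) (cvgM (i1 t) (r2 t)).
Qed.

Lemma ccontinuous_sum (I : Type) (s : seq I) (G : I -> R -> R[i]) :
  (forall i, ccontinuous (G i)) -> ccontinuous (fun t => \sum_(i <- s) G i t).
Proof.
move=> cG; elim: s => [|i s IH].
  by under eq_fun do rewrite big_nil; exact: ccontinuous_cst.
by under eq_fun do rewrite big_cons; exact: ccontinuousD.
Qed.

Lemma continuous_affine (a b : R) : continuous (fun t : R => a * t + b).
Proof.
by move=> t; apply: cvgD; [apply: cvgM; [exact: cvg_cst|exact: cvg_id]|exact: cvg_cst].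
Qed.

Lemma ccontinuous_comp_affine g (a b : R) :
  ccontinuous g -> ccontinuous (fun t => g (a * t + b)).
Proof.
move=> [gr gi]; split=> t.
  by apply: (@continuous_comp _ _ _ (fun t => a * t + b) (fun t => complex.Re (g t)));
    [exact: continuous_affine|exact: gr].
by apply: (@continuous_comp _ _ _ (fun t => a * t + b) (fun t => complex.Im (g t)));
  [exact: continuous_affine|exact: gi].
Qed.

Lemma ccontinuous_cis : ccontinuous (@cis R).
Proof. by split; [exact: continuous_cos|exact: continuous_sin]. Qed.

Lemma continuous_cis : continuous (@cis R).
Proof.
move=> t; apply/cvgrPdist_lt => -[e e'] /= e0.
have /andP[/eqP ee {}e0] : (e' == 0) && (0 < e) by move: e0; rewrite ltcE /= eq_sym.
rewrite ee {ee}; have e2 : 0 < e / 2 by rewrite divr_gt0.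
have cn : \forall s \near t, `|cos t - cos s| < e / 2.
  by have /cvgrPdist_lt := @continuous_cos R t; apply.
have sn : \forall s \near t, `|sin t - sin s| < e / 2.
  by have /cvgrPdist_lt := @continuous_sin R t; apply.
near=> s; rewrite -rnormE ltcR (le_lt_trans (rnorm_le_ReIm _)) //= (splitr e) ltrD //.
  by near: s.
by near: s.
Unshelve. all: by end_near.
Qed.

Lemma ccontinuous_circle (f : R[i] -> R[i]) :
  {within circle, continuous f} -> ccontinuous (fun t => f (cis t)).
Proof.
move=> /subspace_continuousP cf.
have fc t (e : R) : 0 < e -> \forall s \near t, rnorm (f (cis t) - f (cis s)) < e.
  move=> e0; have /cvgrPdist_lt /(_ e%:C) := cf (cis t) (norm_cis t).
  rewrite ltcR => /(_ e0); rewrite near_withinE => h.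
  have h2 : \forall s \near t, circle (cis s) -> `|f (cis t) - f (cis s)| < e%:C.
    exact: (continuous_cis t _ h).
  by apply: filterS h2 => s /(_ (norm_cis s)); rewrite -rnormE ltcR.
split=> t; apply/cvgrPdist_lt => e e0; have := fc t e e0; apply: filterS => s.
  by apply: le_lt_trans; rewrite -ReB; exact: rnorm_Re.
by apply: le_lt_trans; rewrite -ImB; exact: rnorm_Im.
Qed.

Lemma cmeanD g1 g2 : ccontinuous g1 -> ccontinuous g2 ->
  cmean (fun t => g1 t + g2 t) = cmean g1 + cmean g2.
Proof.
move=> [r1 i1] [r2 i2]; rewrite /cmean -mulrDr; congr (_ * _); rewrite /cintegral.
simpc; congr (_ +i* _); rewrite -RintegralD //; try exact: continuous_integrable.
  by apply: eq_Rintegral => t _; case: (g1 t) (g2 t) => ? ? [].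
by apply: eq_Rintegral => t _; case: (g1 t) (g2 t) => ? ? [].
Qed.

Lemma cmeanZ (a : R[i]) g : ccontinuous g ->
  cmean (fun t => a * g t) = a * cmean g.
Proof.
move=> [cr ci]; rewrite /cmean mulrCA; congr (_ * _); rewrite /cintegral.
case: a => x y.
have ir := continuous_integrable _ 0 (2 * pi) cr.
have ii := continuous_integrable _ 0 (2 * pi) ci.
have z (k : R) (h : R -> R) : continuous h ->
  mu.-integrable `[0, 2 * pi] (EFin \o (fun t => k * h t)).
  by move=> ch; apply: continuous_integrable => t; apply: cvgM; [exact: cvg_cst|exact: ch].
simpc; congr (_ +i* _).
  rewrite -!RintegralZl // -RintegralB //; try exact: z.
  by apply: eq_Rintegral => t _; rewrite ReM.
rewrite -!RintegralZl // -RintegralD //; try exact: z.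
by apply: eq_Rintegral => t _; rewrite ImM.
Qed.

Lemma cmean_sum (I : Type) (s : seq I) (G : I -> R -> R[i]) :
  (forall i, ccontinuous (G i)) ->
  cmean (fun t => \sum_(i <- s) G i t) = \sum_(i <- s) cmean (G i).
Proof.
move=> cG; elim: s => [|i s IH].
  under eq_fun do rewrite big_nil; rewrite big_nil.
  by have := cmeanZ 0 (fun=> 0) (ccontinuous_cst 0); rewrite !mul0r.
under eq_fun do rewrite big_cons; rewrite big_cons -IH.
by apply: cmeanD => //; exact: ccontinuous_sum.
Qed.

Lemma cmean_periodic_affine g (a : R) (k : nat) : (0 < k)%N ->
  ccontinuous g -> (forall t, g (t + 2 * pi) = g t) ->
  cmean (fun t => g (k%:R * t + a)) = cmean g.
Proof.
move=> k0 [gr gi] gp; rewrite /cmean /cintegral; congr (_ * (_ +i* _)).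
- apply: (@Rintegral_periodic_affine _ (fun t => complex.Re (g t))) => //.
  + by rewrite mulr_gt0 // pi_gt0.
  + by move=> x; rewrite gp.
- apply: (@Rintegral_periodic_affine _ (fun t => complex.Im (g t))) => //.
  + by rewrite mulr_gt0 // pi_gt0.
  + by move=> x; rewrite gp.
Qed.

Lemma cmean1 : cmean (fun=> 1) = 1.
Proof.
have pi0 : 0 < 2 * pi :> R by rewrite mulr_gt0 // pi_gt0.
have E : fine (@lebesgue_measure R `[0, 2 * pi]) = 2 * pi.
  by rewrite lebesgue_measure_itv /= lte_fin pi0 /= oppr0 addr0.
rewrite /cmean /cintegral /= !Rintegral_cst //= E mul1r mul0r.
by rewrite mulVf // (fmorph_eq0 (real_complex R)) gt_eqF.
Qed.

(** The factor 2 is the price of bounding the real and the imaginary part separately; it only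
    enlarges constants. *)
Lemma rnorm_cmean g (h : R -> R) : ccontinuous g -> continuous h ->
  (forall t, rnorm (g t) <= h t) ->
  rnorm (cmean g) <= 2 * ((2 * pi)^-1 * Rintegral mu `[0, 2 * pi] h).
Proof.
move=> [gr gi] ch gh; have pi0 := pi_gt0 R.
have ih := continuous_integrable _ 0 (2 * pi) ch.
have bnd (u : R -> R) : continuous u -> (forall t, `|u t| <= h t) ->
    `|Rintegral mu `[0, 2 * pi] u| <= Rintegral mu `[0, 2 * pi] h.
  move=> cu uh; apply: le_trans (le_normr_Rintegral _ _) _ => //.
    exact: continuous_integrable.
  apply: le_Rintegral => //.
  apply: continuous_integrable => x.
  by apply: (@continuous_comp _ _ _ u); [exact: cu|exact: norm_continuous].
rewrite /cmean rnormM -(fmorphV (real_complex R)) rnormR ger0_norm; last first.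
  by rewrite invr_ge0 mulr_ge0 // ltW.
rewrite mulrCA ler_wpM2l ?invr_ge0 ?mulr_ge0 ?(ltW pi0) //.
apply: le_trans (rnorm_le_ReIm _) _ => /=.
rewrite [leRHS]mulr_natl [leRHS]mulr2n lerD //; apply: bnd => // t; apply: le_trans (gh t).
  exact: rnorm_Re.
exact: rnorm_Im.
Qed.

End CircleMean.

(** * Jackson approximation *)

Section Differences.
Context {R : realType}.

Lemma fin_diffS {V : lmodType R[i]} m (g : nat -> V) :
  fin_diff m.+1 g = fin_diff m g - fin_diff m (g \o S).
Proof.
transitivity (\sum_(k < m.+2) ((-1) ^+ k * 'C(m, k)%:R : R[i]) *: g k -
    fin_diff m (g \o S)); last first.
  by rewrite big_ord_recr /= bin_small // mulr0 scale0r addr0.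
rewrite /fin_diff big_ord_recl [in RHS]big_ord_recl /= !bin0 -addrA; congr (_ + _).
rewrite -sumrB; apply: eq_bigr => k _.
rewrite /bump /= add1n binS natrD mulrDr scalerDl; congr (_ + _).
by rewrite exprS mulN1r mulNr scaleNr.
Qed.

Lemma iter_DeltaE (f : R[i] -> R[i]) tau m zeta :
  iter m (Delta tau) f zeta =
  (-1) ^+ m * fin_diff m (fun k => f (tau ^+ k * zeta) : R[i]^o).
Proof.
elim: m zeta => [|m IH] zeta.
  by rewrite /fin_diff big_ord_recl big_ord0 /= bin0 !mul1r addr0 scale1r.
rewrite iterS /Delta !IH fin_diffS -mulrBr exprS mulN1r mulNr -mulrN opprB.
congr (_ * (_ - _)); apply: eq_bigr => k _; congr (_ *: f _).
by rewrite /= exprSr mulrA.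
Qed.

(** For [y >= x], halving [y] until it lies between [x] and [2 x] costs [2 ^+ m] per step, in total
    at most [(2 y / x) ^+ m]. The summand 1 covers [y <= x], where monotonicity suffices. *)
Lemma omega_growth (omega : R -> R) m x y :
  (forall x, 0 < x -> 0 < omega x) ->
  (forall x y, 0 < x -> x <= y -> omega x <= omega y) ->
  (forall x, 0 < x -> omega (2 * x) <= 2 ^+ m * omega x) ->
  0 < x -> 0 < y -> omega y <= 2 ^+ m * (1 + (y / x) ^+ m) * omega x.
Proof.
move=> w0 wnd wdb x0 y0; have e2 : 1 <= 2 ^+ m :> R by rewrite exprn_ege1 // ler1n.
have wx := w0 _ x0; have q0 : 0 <= (y / x) ^+ m by rewrite exprn_ge0 // divr_ge0 // ltW.
have [yx|/ltW xy] := leP y x.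
  apply: le_trans (wnd _ _ y0 yx) _; rewrite ler_peMl //; first exact: ltW.
  by rewrite mulr_ege1 // lerDl.
apply: le_trans (_ : 2 ^+ m * (y / x) ^+ m * omega x <= _); last first.
  by rewrite ler_wpM2r ?(ltW wx) // ler_wpM2l ?lerDr // (le_trans ler01).
have [n yn] : exists n, y <= 2 ^+ n * x.
  exists (Num.bound (y / x)); rewrite -ler_pdivrMr //.
  have /ltW h := @archi_boundP R (y / x) (divr_ge0 (ltW y0) (ltW x0)).
  by apply: le_trans h _; rewrite -natrX ler_nat ltnW // ltn_expl.
elim: n y y0 xy yn {q0} => [|n IH] y y0 xy yn.
  have yx : y <= x by rewrite -[leRHS]mul1r.
  apply: le_trans (wnd _ _ y0 yx) _; rewrite ler_peMl //; first exact: ltW.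
  by rewrite mulr_ege1 // exprn_ege1 // ler_pdivlMr // mul1r.
have [y2|/ltW y2] := leP y (2 * x).
  apply: le_trans (wnd _ _ y0 y2) _; apply: le_trans (wdb _ x0) _.
  rewrite ler_wpM2r ?(ltW wx) // ler_peMr ?(le_trans ler01) //.
  by rewrite exprn_ege1 // ler_pdivlMr // mul1r.
have h2 : y = 2 * (y / 2) by rewrite mulrC divfK.
have y20 : 0 < y / 2 by rewrite divr_gt0.
rewrite {1}h2; apply: le_trans (wdb _ y20) _.
have -> : (y / x) ^+ m = 2 ^+ m * (y / 2 / x) ^+ m.
  by rewrite -exprMn; congr (_ ^+ m); field; rewrite gt_eqF.
rewrite -[leRHS]mulrA.
rewrite ler_wpM2l ?(le_trans ler01) //; apply: IH => //.
  by rewrite ler_pdivlMr // mulrC.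
by rewrite ler_pdivrMr // mulrAC -exprSr.
Qed.

End Differences.

(** * The Jackson kernel and its normalisation *)

Section DirichletPower.
Context {R : realType}.

Definition dirichlet M : {poly R} := \poly_(j < M) 1.

(* The Jackson kernel is |D_M^s|^2 with D_M = 1 + z + ... + z^(M-1). *)
Definition jackson_root s M : {poly R} := dirichlet M ^+ s.

Lemma size_jackson_root s M : (0 < M)%N ->
  (size (jackson_root s M) <= (M.-1 * s).+1)%N.
Proof.
move=> M0; apply: leq_trans (size_poly_exp_leq _ _) _.
rewrite ltnS leq_mul2r; apply/orP; right.
by rewrite -!subn1 leq_sub2r // size_poly.
Qed.

(** By Parseval this is the mean of the Jackson kernel over the circle, see [cmean_trig_square]. *)
Definition jackson_norm s M : R :=
  \sum_(j < (M.-1 * s).+1) (jackson_root s M)`_j ^+ 2.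

Lemma sum_sqr_ge n (a : nat -> R) :
  (\sum_(j < n) a j) ^+ 2 <= n%:R * \sum_(j < n) a j ^+ 2.
Proof.
case: n => [|n]; first by rewrite !big_ord0 mulr0 expr0n.
set S := \sum_(j < n.+1) a j; set N := n.+1%:R.
have N0 : 0 < N by rewrite ltr0n.
have : 0 <= \sum_(j < n.+1) (a j - S / N) ^+ 2 by apply: sumr_ge0 => j _; exact: sqr_ge0.
have -> : \sum_(j < n.+1) (a j - S / N) ^+ 2 = \sum_(j < n.+1) a j ^+ 2 - S ^+ 2 / N.
  under eq_bigr do rewrite sqrrB.
  rewrite big_split sumrB /= sumr_const card_ord -[X in _ + X]mulr_natl -/N.
  rewrite sumrMnl -mulr_suml -/S; field.
  by rewrite gt_eqF.
by rewrite subr_ge0 ler_pdivrMr // mulrC.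
Qed.

(** Cauchy-Schwarz: the coefficients of [jackson_root] sum to its value [M ^+ s] at 1, and there are
    [M.-1 * s + 1 <= s * M] of them. *)
Lemma jackson_norm_ge s M : (0 < M)%N -> (0 < s)%N ->
  M%:R ^+ (2 * s) <= s%:R * M%:R * jackson_norm s M.
Proof.
move=> M0 s0; set N := (M.-1 * s).+1.
have -> : M%:R ^+ (2 * s) = (\sum_(j < N) (jackson_root s M)`_j) ^+ 2.
  rewrite mulnC exprM; congr (_ ^+ 2).
  have := horner_coef_wide 1 (size_jackson_root s M M0).
  under eq_bigr do rewrite expr1n mulr1.
  move=> <-; rewrite horner_exp /dirichlet horner_poly.
  by under eq_bigr do rewrite expr1n mulr1; rewrite sumr_const card_ord.
apply: le_trans (sum_sqr_ge _ _) _; rewrite ler_wpM2r //.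
  by apply: sumr_ge0 => j _; exact: sqr_ge0.
rewrite -natrM ler_nat /N mulnC -[X in (_ <= _ * X)%N](prednK M0) mulnS.
by rewrite -addn1 addnC leq_add2r.
Qed.

Lemma jackson_norm_gt0 s M : (0 < M)%N -> (0 < s)%N -> 0 < jackson_norm s M.
Proof.
move=> M0 s0; have sM : 0 < s%:R * M%:R :> R by rewrite mulr_gt0 ?ltr0n.
rewrite -(pmulr_rgt0 _ sM); apply: lt_le_trans (jackson_norm_ge s M M0 s0).
by rewrite exprn_gt0 // ltr0n.
Qed.

Lemma jackson_rootE s M (z : R[i]) : (0 < M)%N ->
  \sum_(j < (M.-1 * s).+1) ((jackson_root s M)`_j)%:C * z ^+ j =
  (\sum_(j < M) z ^+ j) ^+ s.
Proof.
move=> M0.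
transitivity ((map_poly (real_complex R) (jackson_root s M)).[z]).
  rewrite (@horner_coef_wide _ (M.-1 * s).+1) ?size_map_poly ?size_jackson_root //.
  by apply: eq_bigr => j _; rewrite coef_map.
rewrite /jackson_root rmorphXn horner_exp /=; congr (_ ^+ s).
rewrite (@horner_coef_wide _ M) ?size_map_poly ?size_poly //.
by apply: eq_bigr => j _; rewrite coef_map coef_poly ltn_ord mul1r.
Qed.

End DirichletPower.

(** * Means of [f] against single Fourier modes and against squared trigonometric polynomials *)

Section Modes.
Context {R : realType}.
Implicit Types (f : R[i] -> R[i]) (t a : R).

Lemma cis_int (n : int) : cis (n%:~R * (2 * pi) : R) = 1.
Proof.
case: n => n; first by rewrite -[n%:~R]/(n%:R) -cisX cis2pi expr1n.
by rewrite NegzE mulrNz mulNr -conj_cis -[_%:~R]/(n.+1%:R) -cisX cis2pi expr1n conjC1.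
Qed.

Lemma uroot_mod k j j' : (0 < k)%N ->
  uroot k ^+ j * (uroot k ^+ j')^* = 1 :> R[i] -> j = j' %[mod k].
Proof.
move=> k0 h; have wmod n : uroot k ^+ (n %% k) = uroot k ^+ n :> R[i].
  exact/expr_mod/urootQ.
pose o n := Ordinal (ltn_pmod n k0).
have := @uroot_sum R k k0 (o j) (o j').
under eq_bigr do rewrite /= mulnC exprM wmod (mulnC _ (j' %% k)%N) exprM wmod
    rmorphXn -exprMn h expr1n.
rewrite sumr_const card_ord; case: eqP => [/(congr1 val) //|_].
by rewrite mulr0 => /eqP; rewrite pnatr_eq0 -leqn0 leqNgt k0.
Qed.

Lemma cis_periodic t : cis (t + 2 * pi) = cis t.
Proof. by rewrite cisD cis2pi mulr1. Qed.

Lemma ccontinuousX (g : R -> R[i]) n :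
  ccontinuous g -> ccontinuous (fun t => g t ^+ n).
Proof.
move=> cg; elim: n => [|n IH]; first by under eq_fun do rewrite expr0; exact:
    ccontinuous_cst.
by under eq_fun do rewrite exprS; exact: ccontinuousM.
Qed.

Lemma ccontinuous_conj (g : R -> R[i]) :
  ccontinuous g -> ccontinuous (fun t => (g t)^*).
Proof.
move=> [gr gi]; split=> t.
  have -> : (fun t => complex.Re ((g t)^*)) = (fun t => complex.Re (g t)).
    by apply/funext => u; case: (g u).
  exact: gr.
have -> : (fun t => complex.Im ((g t)^*)) = (fun t => - complex.Im (g t)).
  by apply/funext => u; case: (g u).
exact: cvgN (gi t).
Qed.

Lemma ccontinuous_mode f (k j j' : nat) a :
  {within circle, continuous f} ->
  ccontinuous (fun t => cis t ^+ j * (cis t ^+ j')^* * f (cis t ^+ k * cis a)).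
Proof.
move=> cf; have cc := @ccontinuous_cis R.
apply: ccontinuousM.
  by apply: ccontinuousM; [|apply: ccontinuous_conj]; exact: ccontinuousX.
under eq_fun do rewrite cisX -cisD.
exact: (ccontinuous_comp_affine _ k%:R a (ccontinuous_circle f cf)).
Qed.

(** Passing from [t] to [k t + a] preserves means of periodic functions; up to a constant factor the
    integrand is the one of the Fourier coefficient of index [n], taken at [k t + a]. *)
Lemma cmean_mode_dvd f (k j j' : nat) (n : int) a :
  (0 < k)%N -> {within circle, continuous f} -> j'%:Z = j%:Z + k%:Z * n ->
  cmean (fun t => cis t ^+ j * (cis t ^+ j')^* * f (cis t ^+ k * cis a)) =
  fourier f n * cis (n%:~R * a).
Proof.
move=> k0 cf jj; pose h t := f (cis t) * cis (- (n%:~R * t)).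
have ch : ccontinuous h.
  apply: ccontinuousM; first exact: ccontinuous_circle.
  have := ccontinuous_comp_affine _ (- n%:~R) 0 (@ccontinuous_cis R).
  by under eq_fun do rewrite addr0 mulNr.
have jr : j'%:R = j%:R + k%:R * n%:~R :> R.
  by rewrite -[j'%:R]/(j'%:~R) jj intrD intrM.
have -> : (fun t => cis t ^+ j * (cis t ^+ j')^* * f (cis t ^+ k * cis a)) =
          (fun t => cis (n%:~R * a) * h (k%:R * t + a)).
  apply/funext => t; rewrite /h !cisX conj_cis -!cisD mulrC mulrCA -cisD.
  by congr (_ * cis _); rewrite jr; ring.
rewrite cmeanZ; last exact: ccontinuous_comp_affine.
rewrite cmean_periodic_affine //; first by rewrite mulrC.
move=> t; rewrite /h cis_periodic mulrDr opprD cisD -[X in cis X]opprK.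
by rewrite -(conj_cis (_ * (2 * pi))) cis_int conjC1 mulr1 opprK.
Qed.

(** Translating [t] by [2 pi / k] preserves the mean and leaves [cis t ^+ k] unchanged, but
    multiplies the integrand by a constant [c], which differs from 1 unless [j] and [j'] agree
    modulo [k]. *)
Lemma cmean_mode_ndvd f (k j j' : nat) a :
  (0 < k)%N -> {within circle, continuous f} -> ~~ (j == j' %[mod k]) ->
  cmean (fun t => cis t ^+ j * (cis t ^+ j')^* * f (cis t ^+ k * cis a)) = 0.
Proof.
move=> k0 cf jj; set g := (fun t => _); pose b : R := 2 * pi / k%:R.
have cg : ccontinuous g by exact: ccontinuous_mode.
pose c : R[i] := uroot k ^+ j * (uroot k ^+ j')^*.
have : cmean (fun t => g (1%:R * t + b)) = cmean g.
  by apply: cmean_periodic_affine => // t; rewrite /g cis_periodic.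
have -> : (fun t => g (1%:R * t + b)) = (fun t => c * g t).
  apply/funext => t; rewrite /g /c mul1r cisD -/(uroot k) !exprMn urootQ // mulr1.
  by rewrite rmorphM; ring.
rewrite cmeanZ // => /eqP; rewrite -subr_eq0 -[X in _ - X]mul1r -mulrBl mulf_eq0.
case/orP => [|/eqP //]; rewrite subr_eq0 => /eqP /(uroot_mod _ _ _ k0) /eqP.
by rewrite (negbTE jj).
Qed.

(** Analyticity of [f] enters here: modes with [j' < j] could only pick up negative frequencies, so
    what remains are monomials in [cis a] with nonnegative exponents. *)
Lemma cmean_mode f (k j j' : nat) a : (0 < k)%N -> {within circle, continuous f} ->
  (forall n : int, n < 0 -> fourier f n = 0) ->
  cmean (fun t => cis t ^+ j * (cis t ^+ j')^* * f (cis t ^+ k * cis a)) =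
  if (j <= j')%N && (k %| j' - j)%N then
    fourier f ((j' - j) %/ k)%N%:Z * cis a ^+ ((j' - j) %/ k)%N
  else 0.
Proof.
move=> k0 cf f0; case: ifP => [/andP[jj kj]|].
  rewrite (@cmean_mode_dvd _ _ _ _ ((j' - j) %/ k)%N%:Z) //.
    by rewrite cisX.
  by rewrite -PoszM -PoszD mulnC divnK // subnKC.
have [jj /= kj|jj _] := leqP j j'.
  apply: cmean_mode_ndvd => //; apply/negP => /eqP e.
  by move: kj; rewrite -(eqn_mod_dvd k jj) => /eqP; apply; rewrite e.
have [kj|kj] := boolP (k %| j - j')%N; last first.
  by apply: cmean_mode_ndvd => //; rewrite eqn_mod_dvd // ltnW.
rewrite (@cmean_mode_dvd _ _ _ _ (- ((j - j') %/ k)%N%:Z)) //.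
  rewrite f0 ?mul0r // oppr_lt0 ltz_nat divn_gt0 // dvdn_leq // subn_gt0 //.
by rewrite mulrN -PoszM mulnC divnK // -subzn ?(ltnW jj) //; ring.
Qed.

(** Off the diagonal this is [cmean_mode_ndvd] for [f = 1]; the modulus [(j + j').+1] exceeds both
    exponents, so congruence means equality. *)
Lemma cmean_trig (j j' : nat) :
  cmean (fun t => cis t ^+ j * (cis t ^+ j')^* : R[i]) = (j == j')%:R.
Proof.
have c1 : {within @circle R, continuous (fun=> 1 : R[i])}.
  by apply/subspace_continuousP => x _; exact: cvg_cst.
have -> : (fun t => cis t ^+ j * (cis t ^+ j')^*) =
  (fun t => cis t ^+ j * (cis t ^+ j')^* * (fun=> 1) (cis t ^+ (j + j').+1 * cis 0)).
  by apply/funext => t; rewrite mulr1.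
have [<-|jj] := eqVneq j j'.
  transitivity (cmean (fun=> 1 : R[i])); last exact: cmean1.
  by congr cmean; apply/funext => t; rewrite -normCK normrX norm_cis !expr1n mulr1.
apply: (@cmean_mode_ndvd (fun=> 1) (j + j').+1 j j' 0) => //; rewrite !modn_small //.
  by rewrite ltnS leq_addl.
by rewrite ltnS leq_addr.
Qed.

Lemma rnorm_cmean_le (g G : R -> R[i]) : ccontinuous g -> ccontinuous G ->
  (forall t, rnorm (g t) <= complex.Re (G t)) ->
  rnorm (cmean g) <= 2 * complex.Re (cmean G).
Proof.
move=> cg [Gr Gi] gG; apply: le_trans (rnorm_cmean _ _ cg Gr gG) _.
by rewrite ler_wpM2l // /cmean -(fmorphV (real_complex R)) Re_rM.
Qed.

Definition trig_square (a : nat -> R) N t : R[i] :=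
  let z := \sum_(j < N) (a j)%:C * cis t ^+ j in z * z^*.

Lemma trig_squareE (a : nat -> R) N : trig_square a N = fun t =>
  \sum_(j < N) \sum_(j' < N) (a j * a j')%:C * (cis t ^+ j * (cis t ^+ j')^*).
Proof.
apply/funext => t; rewrite /trig_square rmorph_sum mulr_suml.
apply: eq_bigr => j _; rewrite mulr_sumr; apply: eq_bigr => j' _.
by rewrite rmorphM /= conj_Creal ?complex_real // (rmorphM (real_complex R)) /=; ring.
Qed.

Lemma ccontinuous_trig_square (a : nat -> R) N : ccontinuous (trig_square a N).
Proof.
rewrite trig_squareE; apply: ccontinuous_sum => j; apply: ccontinuous_sum => j'.
apply: ccontinuousM; first exact: ccontinuous_cst.
apply: ccontinuousM; [|apply: ccontinuous_conj];
  by apply: ccontinuousX; exact: ccontinuous_cis.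
Qed.

Lemma cmean_trig_square (a : nat -> R) N : cmean (trig_square a N) = (\sum_(j < N)
    a j ^+ 2)%:C.
Proof.
have cc j j' : ccontinuous (fun t => cis t ^+ j * (cis t ^+ j')^* : R[i]).
  by apply: ccontinuousM; [|apply: ccontinuous_conj];
     apply: ccontinuousX; exact: ccontinuous_cis.
have cM j j' : ccontinuous (fun t => (a j * a j')%:C * (cis t ^+ j * (cis t ^+ j')^*)).
  by apply: ccontinuousM => //; exact: ccontinuous_cst.
rewrite trig_squareE cmean_sum => [|j]; last exact: ccontinuous_sum.
rewrite (rmorph_sum (real_complex R)); apply: eq_bigr => j _.
rewrite cmean_sum // (bigD1 j) //= big1 ?addr0 => [|j' jj].
  by rewrite cmeanZ // cmean_trig eqxx mulr1 expr2.
rewrite cmeanZ // cmean_trig; case: eqP => [/val_inj e|_]; last by rewrite mulr0.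
by rewrite e eqxx in jj.
Qed.

(** The mean of [f (cis t ^+ k * zeta)] against the kernel [trig_square a N], computed mode by mode
    as a polynomial in [zeta]; see [cmean_kernel]. *)
Definition kernel_poly (a : nat -> R) N f k : {poly R[i]} :=
  \sum_(j < N) \sum_(j' < N)
    (if (j <= j')%N && (k %| j' - j)%N then
       ((a j * a j')%:C * fourier f ((j' - j) %/ k)%N%:Z) *: 'X^((j' - j) %/ k)
     else 0).

Lemma size_kernel_poly (a : nat -> R) N f k : (size (kernel_poly a N f k) <= N)%N.
Proof.
apply/leq_sizeP => i Ni; rewrite coef_sum big1 // => j _.
rewrite coef_sum big1 // => j' _; case: ifP => _; last by rewrite coef0.
rewrite coefZ coefXn gtn_eqF ?mulr0 //; apply: leq_ltn_trans (leq_div _ _) _.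
by apply: leq_ltn_trans (leq_subr _ _) _; apply: leq_trans (ltn_ord j') Ni.
Qed.

Lemma cmean_kernel (a : nat -> R) N f k zeta : (0 < k)%N -> {within circle, continuous f} ->
  (forall n : int, n < 0 -> fourier f n = 0) -> circle zeta ->
  cmean (fun t => trig_square a N t * f (cis t ^+ k * zeta)) =
  (kernel_poly a N f k).[zeta].
Proof.
move=> k0 cf f0 /cis_surj[b ->].
have cm j j' := ccontinuous_mode f k j j' b cf.
have cM j j' : ccontinuous (fun t => (a j * a j')%:C *
   (cis t ^+ j * (cis t ^+ j')^* * f (cis t ^+ k * cis b))).
  by apply: ccontinuousM => //; exact: ccontinuous_cst.
have -> : (fun t => trig_square a N t * f (cis t ^+ k * cis b)) = (fun t =>
   \sum_(j < N) \sum_(j' < N) (a j * a j')%:C *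
   (cis t ^+ j * (cis t ^+ j')^* * f (cis t ^+ k * cis b))).
  apply/funext => t; rewrite trig_squareE mulr_suml; apply: eq_bigr => j _.
  by rewrite mulr_suml; apply: eq_bigr => j' _; rewrite !mulrA.
rewrite cmean_sum => [|j]; last exact: ccontinuous_sum.
rewrite /kernel_poly horner_sum; apply: eq_bigr => j _.
rewrite cmean_sum // horner_sum; apply: eq_bigr => j' _.
rewrite cmeanZ // cmean_mode //; case: ifP => _; last by rewrite mulr0 horner0.
by rewrite hornerZ hornerXn mulrA.
Qed.

End Modes.

Section Jackson.
Context {R : realType}.
Variables (m : nat) (m_gt0 : (0 < m)%N) (f : R[i] -> R[i]).
Hypothesis cf : {within circle, continuous f}.
Hypothesis f_neg : forall n : int, n < 0 -> fourier f n = 0.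

Local Notation s := m.+1.
Local Notation N M := (M.-1 * s).+1.
Local Notation a M := (fun j : nat => (@jackson_root R s M)`_j).
Local Notation nrm M := (@jackson_norm R s M).

(** In the mean of the [m]-th difference of [f] along [cis t ^+ k * zeta], the summand [k = 0]
    reproduces [f zeta]. The others, reindexed from 0 and negated, form this polynomial, so that [f]
    minus it is the mean of the difference. *)
Definition jackson_poly M : {poly R[i]} :=
  - \sum_(k < m) ((-1) ^+ k.+1 * 'C(m, k.+1)%:R * (nrm M)%:C^-1) *:
      kernel_poly (a M) (N M) f k.+1.

Lemma size_jackson_poly M : (size (jackson_poly M) <= (M.-1 * m.+1).+1)%N.
Proof.
rewrite size_polyN; apply: leq_trans (size_sum _ _ _) _.
apply/bigmax_leqP => k _; apply: leq_trans (size_scale_leq _ _) _.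
exact: size_kernel_poly.
Qed.

Lemma rnorm_trig_square (b : nat -> R) n t :
  rnorm (trig_square b n t) = rnorm (\sum_(j < n) (b j)%:C * cis t ^+ j) ^+ 2.
Proof. by rewrite /trig_square rnormM rnorm_conj expr2. Qed.

Lemma Re_trig_square (b : nat -> R) n t :
  complex.Re (trig_square b n t) = rnorm (\sum_(j < n) (b j)%:C * cis t ^+ j) ^+ 2.
Proof. by rewrite /trig_square -normCK -rnormE -(rmorphXn (real_complex R)). Qed.

Lemma jackson_remainder M zeta : (0 < M)%N -> circle zeta ->
  (nrm M)%:C * (f zeta - (jackson_poly M).[zeta]) =
  cmean (fun t => trig_square (a M) (N M) t *
    fin_diff m (fun k => f (cis t ^+ k * zeta) : R[i]^o)).
Proof.
move=> M0 cz; have n0 := @jackson_norm_gt0 R s M M0 isT.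
have nc : (nrm M)%:C != 0 by rewrite realc_eq0 gt_eqF.
have /cis_surj[b zb] := cz.
have cK k : ccontinuous (fun t => trig_square (a M) (N M) t * f (cis t ^+ k * zeta)).
  apply: ccontinuousM; first exact: ccontinuous_trig_square.
  have := ccontinuous_comp_affine _ k%:R b (ccontinuous_circle f cf).
  by rewrite zb; under [X in _ -> ccontinuous X]eq_fun do rewrite cisX -cisD.
have -> : (fun t => trig_square (a M) (N M) t *
    fin_diff m (fun k => f (cis t ^+ k * zeta) : R[i]^o)) = (fun t =>
    \sum_(k < m.+1) ((-1) ^+ k * 'C(m, k)%:R) *
      (trig_square (a M) (N M) t * f (cis t ^+ k * zeta))).
  apply/funext => t; rewrite /fin_diff mulr_sumr; apply: eq_bigr => k _.
  by rewrite /GRing.scale /= mulrCA.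
rewrite cmean_sum => [|k]; last by apply: ccontinuousM => //; exact: ccontinuous_cst.
rewrite big_ord_recl mulrBr; congr (_ + _).
  rewrite cmeanZ //= bin0 !mul1r.
  have -> : (fun t => trig_square (a M) (N M) t * f (cis t ^+ 0 * zeta)) =
      (fun t => f zeta * trig_square (a M) (N M) t).
    by apply/funext => t; rewrite expr0 mul1r mulrC.
  by rewrite cmeanZ ?cmean_trig_square 1?mulrC //; exact: ccontinuous_trig_square.
rewrite hornerN mulrN opprK horner_sum mulr_sumr; apply: eq_bigr => k _.
rewrite cmeanZ // hornerZ cmean_kernel //.
by rewrite [_ * _^-1]mulrC !mulrA divff // mul1r.
Qed.

Variables (omega : R -> R) (L : R).
Hypothesis omega_pos : forall x, 0 < x -> 0 < omega x.
Hypothesis omega_nd : forall x y, 0 < x -> x <= y -> omega x <= omega y.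
Hypothesis omega_db : forall x, 0 < x -> omega (2 * x) <= 2 ^+ m * omega x.
Hypothesis L0 : 0 <= L.
Hypothesis f_smooth : forall tau zeta, circle tau -> tau != 1 -> circle zeta ->
  rnorm (iter m (Delta tau) f zeta) <= L * omega (rnorm (1 - tau)).

(** In front, 2 comes from [rnorm_cmean_le] and [2 ^+ m] from [omega_growth]; in the bracket,
    [2 ^+ m] comes from [x * d <= 2] and [m.+1] from [jackson_norm_ge]. *)
Definition jackson_const : R := 2 ^+ m.+1 * (1 + 2 ^+ m * m.+1%:R).

(** Let [x = |1 - cis t|] and [d] the modulus of the Dirichlet sum, so that
    [x * d = |1 - cis t ^+ M| <= 2]. The kernel has [2 m + 2] factors [d]: [m] of them absorb the
    [x ^+ m] from [omega_growth], another [m] are bounded by [M], and the last two have mean [M] by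
    Parseval. The resulting power [M ^+ (2 m + 1)] is compared with the normalisation by
    [jackson_norm_ge]. *)
Lemma jackson_approx M zeta : (0 < M)%N -> circle zeta ->
  rnorm (f zeta - (jackson_poly M).[zeta]) <=
  jackson_const * L * omega (M%:R^-1).
Proof.
move=> M0 cz; have n0 := @jackson_norm_gt0 R s M M0 isT.
have Mr : 0 < M%:R :> R by rewrite ltr0n.
have wM : 0 < omega M%:R^-1 by rewrite omega_pos // invr_gt0.
pose c1 := L * omega M%:R^-1 * 2 ^+ m.
pose c2 := c1 * 2 ^+ m * M%:R ^+ m * M%:R ^+ m.
have c10 : 0 <= c1 by rewrite !mulr_ge0 ?exprn_ge0 // ltW.
have pw (x : R) : 0 <= x -> 0 <= x ^+ m by exact: exprn_ge0.
have c20 : 0 <= c2 by do 3?apply: mulr_ge0 => //; apply: pw => //; rewrite ltW.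
(* The majorant is a combination of squared trigonometric polynomials, so its mean is known
   exactly. *)
pose G t := c1%:C * trig_square (a M) (N M) t + c2%:C * trig_square (fun=> 1) M t.
have cT b n := ccontinuous_trig_square b n : ccontinuous (@trig_square R b n).
have cZ (c : R[i]) b n : ccontinuous (fun t => c * @trig_square R b n t).
  by apply: ccontinuousM => //; exact: ccontinuous_cst.
have cG : ccontinuous G by exact: ccontinuousD.
have GE : complex.Re (cmean G) = c1 * nrm M + c2 * M%:R.
  rewrite /G cmeanD // !cmeanZ // !cmean_trig_square.
  rewrite -!(rmorphM (real_complex R)) -(rmorphD (real_complex R)) /=.
  congr (_ + _ * _); under eq_bigr do rewrite expr1n.
  by rewrite sumr_const card_ord.
set g := (fun t => trig_square (a M) (N M) t *
    fin_diff m (fun k => f (cis t ^+ k * zeta) : R[i]^o)).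
have cg : ccontinuous g.
  apply: ccontinuousM => //; apply: ccontinuous_sum => k.
  apply: ccontinuousM; first exact: ccontinuous_cst.
  have /cis_surj[b ->] := cz.
  have := ccontinuous_comp_affine _ k%:R b (ccontinuous_circle f cf).
  by under [X in _ -> ccontinuous X]eq_fun do rewrite cisX -cisD.
have gG t : rnorm (g t) <= complex.Re (G t).
  have -> : complex.Re (G t) = c1 * complex.Re (trig_square (a M) (N M) t) +
     c2 * complex.Re (trig_square (fun=> 1) M t) by rewrite /G -!Re_rM; case: (_ *
         _) (c2%:C * _) => ? ? [].
  rewrite !Re_trig_square rnormM rnorm_trig_square jackson_rootE // rnormX.
  under [X in _ <= _ + _ * rnorm X ^+ 2]eq_bigr do rewrite mul1r.
  set d := rnorm (\sum_(j < M) _); have d0 : 0 <= d by exact: rnorm_ge0.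
  have dM : d <= M%:R.
    apply: le_trans (rnorm_sum _ _ _ _ _) _.
    under eq_bigr do rewrite rnormX rnorm_cis expr1n.
    by rewrite sumr_const card_ord.
  (* Smoothness says nothing at [tau = 1], but there the difference vanishes since [m > 0]. *)
  have [t1|t1] := eqVneq (cis t) 1.
    have -> : fin_diff m (fun k => f (cis t ^+ k * zeta) : R[i]^o) = 0.
      rewrite /fin_diff; under eq_bigr do rewrite t1 expr1n mul1r.
      rewrite -scaler_suml; have := @fin_diff_pow R m 0 m_gt0.
      by under eq_bigr do rewrite expr0 mulr1; move=> ->; rewrite scale0r.
    by rewrite rnorm0 mulr0 addr_ge0 // mulr_ge0 // sqr_ge0.
  set x := rnorm (1 - cis t).
  have x0 : 0 < x.
    rewrite lt_neqAle rnorm_ge0 andbT eq_sym; apply/eqP => /rnorm_eq0 /subr0_eq e.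
    by rewrite e eqxx in t1.
  have xd : x * d <= 2.
    rewrite /x /d -rnormM.
    have -> : (1 - cis t) * (\sum_(j < M) cis t ^+ j) = 1 - cis t ^+ M.
      by rewrite -opprB mulNr -subrX1 opprB.
    by apply: le_trans (rnormB_le _ _ _) _; rewrite rnorm1 rnormX rnorm_cis expr1n.
  have fd : rnorm (fin_diff m (fun k => f (cis t ^+ k * zeta) : R[i]^o)) <= L * omega x.
    have := f_smooth (cis t) zeta (norm_cis t) t1 cz.
    by rewrite iter_DeltaE rnormM rnormX rnormN rnorm1 expr1n mul1r.
  have wx : omega x <= 2 ^+ m * (1 + (x * M%:R) ^+ m) * omega M%:R^-1.
    have := omega_growth omega m M%:R^-1 x omega_pos omega_nd omega_db.
    by rewrite invrK invr_gt0; apply.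
  apply: le_trans (_ : (d ^+ s) ^+ 2 * (L * (2 ^+ m * (1 + (x * M%:R) ^+ m) * omega
      M%:R^-1)) <= _).
    by rewrite ler_wpM2l ?sqr_ge0 // (le_trans fd) // ler_wpM2l.
  have -> : (d ^+ s) ^+ 2 * (L * (2 ^+ m * (1 + (x * M%:R) ^+ m) * omega M%:R^-1)) =
     c1 * (d ^+ s) ^+ 2 + (c1 * (x * d) ^+ m * M%:R ^+ m * d ^+ m) * d ^+ 2.
    by rewrite /c1 !exprMn (exprS d m); ring.
  rewrite lerD2l ler_wpM2r ?sqr_ge0 // /c2.
  by rewrite !ler_pM ?mulr_ge0 ?exprn_ge0 ?lerXn2r ?nnegrE ?mulr_ge0 // ltW.
have := rnorm_cmean_le g G cg cG gG; rewrite GE -jackson_remainder //.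
rewrite rnormM rnormR gtr0_norm // => h.
rewrite -(ler_pM2l n0) (le_trans h) //.
have nM : M%:R ^+ m * M%:R ^+ m * M%:R <= s%:R * nrm M :> R.
  rewrite -(ler_pM2l Mr) mulrA [leRHS]mulrA [X in _ <= X * _]mulrC.
  apply: le_trans (@jackson_norm_ge R s M M0 isT).
  by rewrite mul2n -addnn exprD (exprS M%:R m) le_eqVlt; apply/orP; left; apply/eqP; ring.
have : c1 * 2 ^+ m * (M%:R ^+ m * M%:R ^+ m * M%:R) <= c1 * 2 ^+ m * (s%:R * nrm M).
  by rewrite ler_wpM2l // mulr_ge0 // exprn_ge0.
have -> : c1 * 2 ^+ m * (M%:R ^+ m * M%:R ^+ m * M%:R) = c2 * M%:R by rewrite /c2; ring.
move=> h2; apply: le_trans (_ : 2 * (c1 * nrm M + c1 * 2 ^+ m * (s%:R * nrm M)) <= _).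
  by rewrite ler_wpM2l // lerD2l.
by rewrite /jackson_const /c1 exprS le_eqVlt; apply/orP; left; apply/eqP; ring.
Qed.

End Jackson.

(** * Functional calculus on the disk algebra *)

Section Limits.
Context {R : realType}.

Lemma ltc0P (e : R[i]) : 0 < e -> exists2 r : R, 0 < r & e = r%:C.
Proof.
case: e => r e'; rewrite ltcE /= => /andP[/eqP e0 r0].
by exists r => //; rewrite e0.
Qed.

Lemma ltc_realP (r : R) : 0 < r -> 0 < r%:C :> R[i].
Proof. by rewrite -[0 : R[i]]/(0%:C) ltcR. Qed.

Lemma cauchy_rate {V : completeNormedModType R[i]} (u : nat -> V) (e : nat -> R) :
  e n @[n --> \oo] --> 0 ->
  (forall n k, rnorm (u n - u k) <= e n + e k) ->
  exists l, forall n, rnorm (u n - l) <= e n.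
Proof.
move=> e0 ue.
have en d : 0 < d -> \forall n \near \oo, e n < d.
  by move=> d0; exact: (cvgr_lt _ e0).
have uc : cvg (u @ \oo).
  apply: cauchy_cvg; apply: cauchy_exP => _ /ltc0P[d d0 ->].
  have d2 : 0 < d / 2 by rewrite divr_gt0.
  have [n0 _ hn0] := en _ d2.
  exists (u n0); exists n0 => // k /= nk.
  rewrite -ball_normE /ball_ /= -rnormE ltcR.
  by apply: le_lt_trans (ue _ _) _; rewrite (splitr d) ltrD // hn0 //= leqnn.
exists (lim (u @ \oo)) => n; apply/ler_addgt0Pr => d d0.
have d2 : 0 < d / 2 by rewrite divr_gt0.
have /cvgrPdist_lt /(_ _ (ltc_realP _ d2)) hl := uc.
have [k [h1 h2]] := filter_ex (filterI hl (en _ d2)).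
have -> : u n - lim (u @ \oo) = (u n - u k) - (lim (u @ \oo) - u k).
  by rewrite opprB addrA subrK.
apply: le_trans (rnormB_le _ _ _) _; have := ue n k.
by move: h1; rewrite -rnormE ltcR; lra.
Qed.

Lemma cauchy_rate_complex (u : nat -> R[i]) (e : nat -> R) :
  e n @[n --> \oo] --> 0 ->
  (forall n k, rnorm (u n - u k) <= e n + e k) ->
  exists l, forall n, rnorm (u n - l) <= e n.
Proof.
move=> e0 ue.
have en d : 0 < d -> \forall n \near \oo, e n < d.
  by move=> d0; exact: (cvgr_lt _ e0).
have cvR (v : nat -> R) : (forall n k, `|v n - v k| <= e n + e k) -> cvg (v @ \oo).
  move=> ve; apply: cauchy_cvg; apply: cauchy_exP => d d0.
  have d2 : 0 < d / 2 by rewrite divr_gt0.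
  have [n0 _ hn0] := en _ d2.
  exists (v n0); exists n0 => // k /= nk.
  rewrite -ball_normE /ball_ /=.
  by apply: le_lt_trans (ve _ _) _; rewrite (splitr d) ltrD // hn0 //= leqnn.
have cr : cvg ((fun n => complex.Re (u n)) @ \oo).
  by apply: cvR => n k; rewrite -ReB (le_trans (rnorm_Re _)).
have ci : cvg ((fun n => complex.Im (u n)) @ \oo).
  by apply: cvR => n k; rewrite -ImB (le_trans (rnorm_Im _)).
set x := lim ((fun n => complex.Re (u n)) @ \oo) in cr.
set y := lim ((fun n => complex.Im (u n)) @ \oo) in ci.
exists (x +i* y) => n; apply/ler_addgt0Pr => d d0.
have d3 : 0 < d / 3 by rewrite divr_gt0.
have /cvgrPdist_lt /(_ _ d3) hr := cr.
have /cvgrPdist_lt /(_ _ d3) hi := ci.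
have [k [[h1 h2] h3]] := filter_ex (filterI (filterI hr hi) (en _ d3)).
have -> : u n - x +i* y = (u n - u k) - (x +i* y - u k) by ring.
apply: le_trans (rnormB_le _ _ _) _; have := ue n k.
have := rnorm_le_ReIm (x +i* y - u k); rewrite ReB ImB /=.
by move: h1 h2; lra.
Qed.

Lemma uniform_disk_cvgP (p : nat -> {poly R[i]}) (F : R[i] -> R[i]) :
  {uniform closed_disk, (fun n z => (p n).[z]) @ \oo --> F} <->
  forall d : R, 0 < d ->
    \forall n \near \oo, forall z, closed_disk z -> rnorm (F z - (p n).[z]) < d.
Proof.
split=> [h d d0|h].
  have := h [set g | forall z, closed_disk z -> rnorm (F z - g z) < d]; apply.
  apply/uniform_nbhs; exists [set xy | ball xy.1 (d%:C : R[i]) xy.2]; split.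
    by rewrite -entourage_ballE; exists d%:C => //=; exact: ltc_realP.
  move=> g /= hg z hz; have := hg z hz.
  by rewrite -ball_normE /ball_ /= -rnormE ltcR.
move=> P /uniform_nbhs[E [entE EP]].
move: entE; rewrite -entourage_ballE => -[_ /= /ltc0P[d d0 ->] dE].
have := h d d0; apply: filterS => n hn; apply: EP => z hz; apply: dE => /=.
by rewrite -ball_normE /ball_ /= -rnormE ltcR hn.
Qed.

End Limits.

(** * Approximation on the circle carried over to the closed disk *)

Section DiskExtension.
Context {R : realType}.
Implicit Types (f : R[i] -> R[i]) (p : {poly R[i]}).

Lemma ccontinuous_horner p : ccontinuous (fun t : R => p.[cis t]).
Proof.
under eq_fun do rewrite horner_coef.
apply: ccontinuous_sum => j; apply: ccontinuousM; first exact: ccontinuous_cst.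
by apply: ccontinuousX; exact: ccontinuous_cis.
Qed.

Lemma cmean_coef p j : cmean (fun t : R => p.[cis t] * (cis t ^+ j)^*) = p`_j.
Proof.
have cc i : ccontinuous (fun t => cis t ^+ i * (cis t ^+ j)^* : R[i]).
  by apply: ccontinuousM; [|apply: ccontinuous_conj];
     apply: ccontinuousX; exact: ccontinuous_cis.
have -> : (fun t => p.[cis t] * (cis t ^+ j)^*) = (fun t =>
    \sum_(i < maxn (size p) j.+1) p`_i * (cis t ^+ i * (cis t ^+ j)^*)).
  apply/funext => t; rewrite (horner_coef_wide _ (leq_maxl (size p) j.+1)).
  by rewrite mulr_suml; apply: eq_bigr => i _; rewrite mulrA.
rewrite cmean_sum => [|i]; last by apply: ccontinuousM => //; exact: ccontinuous_cst.
have jm : (j < maxn (size p) j.+1)%N by rewrite leq_max leqnn orbT.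
rewrite (bigD1 (Ordinal jm)) //= big1 ?addr0 => [|i ij].
  by rewrite cmeanZ // cmean_trig eqxx mulr1.
rewrite cmeanZ // cmean_trig; case: eqP => [e|_]; last by rewrite mulr0.
by case/eqP: ij; apply: val_inj.
Qed.

Lemma fourier_nat f (j : nat) :
  fourier f j%:Z = cmean (fun t => f (cis t) * (cis t ^+ j)^*).
Proof.
rewrite /fourier -/(cmean _); congr cmean; apply/funext => t.
by rewrite cisX conj_cis.
Qed.

Lemma fourier_approx f p (e : R) (j : nat) : {within circle, continuous f} ->
  (forall z, circle z -> rnorm (f z - p.[z]) <= e) ->
  rnorm (fourier f j%:Z - p`_j) <= 2 * e.
Proof.
move=> cf fe; rewrite fourier_nat -cmean_coef.
have cj : ccontinuous (fun t : R => (cis t ^+ j)^*).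
  by apply: ccontinuous_conj; apply: ccontinuousX; exact: ccontinuous_cis.
have c1 : ccontinuous (fun t => f (cis t) * (cis t ^+ j)^*).
  by apply: ccontinuousM => //; exact: ccontinuous_circle.
have c2 : ccontinuous (fun t => p.[cis t] * (cis t ^+ j)^*).
  by apply: ccontinuousM => //; exact: ccontinuous_horner.
have c3 : ccontinuous (fun t => -1 * (p.[cis t] * (cis t ^+ j)^*)).
  by apply: ccontinuousM => //; exact: ccontinuous_cst.
rewrite -[- cmean _]mulN1r -cmeanZ // -cmeanD //.
have -> : e = complex.Re (cmean (fun=> e%:C * 1 : R[i])).
  by rewrite cmeanZ ?cmean1 ?mulr1 //; exact: ccontinuous_cst.
apply: rnorm_cmean_le; [exact: ccontinuousD|exact: ccontinuous_cst|move=> t].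
rewrite mulr1 /= mulN1r -mulrBl rnormM rnorm_conj rnormX rnorm_cis expr1n mulr1.
exact/fe/norm_cis.
Qed.

(** Inside the disk two limits are identified: that of [(P n).[z]], which exists by [max_modulus],
    and the power series defining [disk_ext]. The coefficients of [P k] are within [2 * e k] of
    those of [f], so beyond the degree of [P k] the partial sums differ from the first limit by at
    most [e k] times a constant from the geometric series in [|z|]. *)
Lemma disk_ext_approx f (P : nat -> {poly R[i]}) (e : nat -> R) :
  {within circle, continuous f} -> e n @[n --> \oo] --> 0 ->
  (forall n z, circle z -> rnorm (f z - (P n).[z]) <= e n) ->
  forall n z, closed_disk z -> rnorm (disk_ext f z - (P n).[z]) <= e n.
Proof.
move=> cf e0 fe n z hz; rewrite /disk_ext; case: ifPn => z1; last first.
  apply: fe; rewrite /circle /=; move: hz; rewrite /closed_disk /= le_eqVlt.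
  by rewrite (negbTE z1) orbF => /eqP.
have ep k : 0 <= e k.
  by apply: le_trans (rnorm_ge0 _ _) (fe k 1 _); rewrite /circle /= normr1.
have PP k l : rnorm ((P k).[z] - (P l).[z]) <= e k + e l.
  rewrite -hornerN -hornerD; apply: max_modulus; last by rewrite -lecR rnormE.
  move=> y hy; rewrite hornerD hornerN.
  have -> : (P k).[y] - (P l).[y] = (f y - (P l).[y]) - (f y - (P k).[y]) by ring.
  by apply: le_trans (rnormB_le _ _ _) _; rewrite addrC lerD // fe.
have [v hv] := cauchy_rate_complex (fun k => (P k).[z]) e e0 PP.
set r := rnorm z; have r0 : 0 <= r by exact: rnorm_ge0.
have r1 : r < 1 by rewrite -ltcR rnormE.
have geo K : \sum_(j < K) r ^+ j <= (1 - r)^-1.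
  rewrite -[leRHS]mul1r ler_pdivlMr ?subr_gt0 // mulrC -opprB mulNr -subrX1 opprB.
  by rewrite gerBl exprn_ge0.
pose u j := fourier f j%:Z * z ^+ j.
have SP k K : (size (P k) <= K)%N ->
    rnorm (v - series u K) <= e k * (1 + 2 * (1 - r)^-1).
  move=> kK.
  have -> : v - series u K = (v - (P k).[z]) - (series u K - (P k).[z]).
    by rewrite opprB addrA subrK.
  apply: le_trans (rnormB_le _ _ _) _; rewrite mulrDr mulr1 lerD 1?rnorm_distC ?hv //.
  rewrite /series /= big_mkord (horner_coef_wide _ kK) -sumrB.
  apply: le_trans (rnorm_sum _ _ _ _ _) _; rewrite mulrA (mulrC (e k)).
  apply: le_trans (_ : \sum_(j < K) 2 * e k * r ^+ j <= _); last first.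
    by rewrite -mulr_sumr ler_wpM2l // mulr_ge0.
  apply: ler_sum => j _; rewrite /u -mulrBl rnormM rnormX ler_wpM2r ?exprn_ge0 //.
  by rewrite rnorm_distC; apply: fourier_approx => // y hy; exact: fe.
have -> : limn (series u) = v; last by rewrite rnorm_distC.
apply: cvg_lim; first exact: norm_hausdorff.
apply/cvgrPdist_lt => _ /ltc0P[d d0 ->].
set C := 1 + 2 * (1 - r)^-1 in SP.
have C0 : 0 < C by rewrite ltr_pwDl // mulr_ge0 // invr_ge0 subr_ge0 ltW.
have dC : 0 < d / C by rewrite divr_gt0.
have [k hk] : exists k, e k < d / C.
  by have [k hk] := filter_ex (cvgr_lt _ e0 _ dC); exists k.
exists (size (P k)) => // K /= kK; rewrite -rnormE ltcR.
by apply: le_lt_trans (SP _ _ kK) _; rewrite -ltr_pdivlMr.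
Qed.

End DiskExtension.

Section DiskCalculus.
Context {R : realType} {H : hilbertType R}.
Implicit Types (T : {linear H -> H}) (p : {poly R[i]}) (F : R[i] -> R[i]).

Lemma poly_calcE p (T : H -> H) x : poly_calc p T x = pcalc p T x.
Proof. by rewrite /poly_calc fct_sumE. Qed.

Lemma opnorm_ge0 (A : H -> H) : (0 <= opnorm A)%E.
Proof.
apply: le_trans (ereal_sup_ubound (ex_intro2 _ _ 0 _ erefl)); last by rewrite /= normr0.
by rewrite lee_fin rnorm_ge0.
Qed.

Lemma opnorm_leP (A : H -> H) (c : R) :
  (opnorm A <= c%:E)%E <-> forall x : H, `|x| <= 1 -> rnorm (A x) <= c.
Proof.
split=> [h x x1|h].
  rewrite -lee_fin; apply: le_trans h; apply: ereal_sup_ubound.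
  by exists x.
by apply: ge_ereal_sup => _ [x /= x1 <-]; rewrite lee_fin h.
Qed.

Lemma linear_opnorm_leP (T : {linear H -> H}) (c : R) : 0 <= c ->
  (opnorm T <= c%:E)%E <-> forall x, rnorm (T x) <= c * rnorm x.
Proof.
move=> c0; rewrite opnorm_leP; split=> h x; last first.
  rewrite -rnormE -[1]/(1%:C) lecR => x1.
  by apply: le_trans (h x) _; rewrite ler_piMr.
have [/rnorm_eq0 ->|x0] := eqVneq (rnorm x) 0.
  by rewrite linear0 rnorm0 mulr0.
have xp : 0 < rnorm x by rewrite lt_neqAle eq_sym x0 rnorm_ge0.
have := h ((rnorm x)^-1%:C *: x); rewrite linearZ /= rnormZ rnormR ger0_norm; last first.
  by rewrite invr_ge0 ltW.
rewrite ler_pdivrMl // mulrC; apply.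
by rewrite -rnormE rnormZ rnormR ger0_norm ?invr_ge0 ?(ltW xp) // mulVf.
Qed.

Lemma contractionP (T : {linear H -> H}) :
  op_contraction T <-> forall x, rnorm (T x) <= rnorm x.
Proof.
rewrite /op_contraction (linear_opnorm_leP T 1) //.
by split=> h x; have := h x; rewrite mul1r.
Qed.

Lemma von_neumann_ball T p (M : R) (x : H) : (forall x, rnorm (T x) <= rnorm x) ->
  (forall z, circle z -> rnorm p.[z] <= M) -> `|x| <= 1 -> rnorm (pcalc p T x) <= M.
Proof.
move=> hT hp; rewrite -rnormE -[1]/(1%:C) lecR => x1.
have M0 : 0 <= M.
  by apply: le_trans (rnorm_ge0 _ p.[1]) (hp _ _); rewrite /circle /= normr1.
by apply: le_trans (von_neumann _ p M hT hp x) _; rewrite ler_piMr.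
Qed.

(** The limit is taken vector by vector, but von Neumann's inequality gives the rate
    [e n * rnorm x], hence convergence in operator norm. *)
Lemma is_disk_calc_ex F (P : nat -> {poly R[i]}) (e : nat -> R) T :
  op_contraction T -> e n @[n --> \oo] --> 0 ->
  (forall n z, closed_disk z -> rnorm (F z - (P n).[z]) <= e n) ->
  exists A, is_disk_calc F T A.
Proof.
move=> /contractionP hT e0 FP.
have cd z : circle z -> closed_disk z by rewrite /circle /closed_disk /= => ->.
have PP n k z : circle z -> rnorm (P n - P k).[z] <= e n + e k.
  move=> /cd hz; rewrite hornerD hornerN.
  have -> : (P n).[z] - (P k).[z] = (F z - (P k).[z]) - (F z - (P n).[z]) by ring.
  by apply: le_trans (rnormB_le _ _ _) _; rewrite addrC lerD // FP.
have ex (x : H) : exists l, forall n, rnorm (pcalc (P n) T x - l) <= e n * rnorm x.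
  apply: (@cauchy_rate _ _ (fun n => pcalc (P n) T x) (fun n => e n * rnorm x)).
    by rewrite -(mul0r (rnorm x)); apply: cvgM => //; exact: cvg_cst.
  by move=> n k; rewrite -pcalcB -mulrDl; apply: von_neumann => // z; exact: PP.
pose A x := projT1 (cid (ex x)).
have AE x n : rnorm (pcalc (P n) T x - A x) <= e n * rnorm x.
  exact: projT2 (cid (ex x)) n.
have Pl n a x y : pcalc (P n) T (a *: x + y) = a *: pcalc (P n) T x + pcalc (P n) T y.
  rewrite /pcalc scaler_sumr -big_split; apply: eq_bigr => i _ /=.
  have -> : iter i T (a *: x + y) = a *: iter i T x + iter i T y.
    by elim: (nat_of_ord i) => //= j ->; rewrite linearP.
  by rewrite scalerDr !scalerA mulrC.
exists A; split.
  (* The defect of linearity of [A] is independent of [n] and at most [e n * K], because each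
     [pcalc (P n) T] is linear. *)
  move=> a x y; apply/subr0_eq/rnorm_eq0/eqP; rewrite eq_le rnorm_ge0 andbT.
  pose K := rnorm (a *: x + y) + rnorm a * rnorm x + rnorm y.
  have eK : e n * K @[n --> \oo] --> 0.
    by rewrite -(mul0r K); apply: cvgM => //; exact: cvg_cst.
  apply: (cvgr_to_ge eK); apply: nearW => n.
  have -> : A (a *: x + y) - (a *: A x + A y) =
     (a *: (pcalc (P n) T x - A x) + (pcalc (P n) T y - A y)) -
     (pcalc (P n) T (a *: x + y) - A (a *: x + y)).
    have zz (w b c p q : H) : w - (b + c) = (p - b + (q - c)) - (p + q - w).
      by rewrite (addrACA p (- b)) -[- b - c]opprD opprB [RHS]addrC addrA subrK.
    by rewrite Pl scalerBr; exact: zz.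
  apply: le_trans (rnormB_le _ _ _) _.
  rewrite /K !mulrDr addrC -addrA lerD ?AE //.
  apply: le_trans (rnormD_le _ _ _) _; rewrite rnormZ lerD ?AE //.
  by rewrite mulrCA ler_wpM2l ?rnorm_ge0 // AE.
exists P; split.
  apply/uniform_disk_cvgP => d d0; have [n0 _ hn0] := cvgr_lt _ e0 _ d0.
  by exists n0 => // n nn z hz; apply: le_lt_trans (hn0 n nn); exact: FP.
have ee : (e n)%:E @[n --> \oo] --> 0%E by apply: cvg_EFin => //; exact: nearW.
apply: (@squeeze_cvge _ _ _ _ (fun=> 0%E) _ _ _ _ (cvg_cst _) ee).
apply: nearW => n; rewrite opnorm_ge0 /=; apply/opnorm_leP => x.
rewrite -rnormE -[1]/(1%:C) lecR => x1.
rewrite [X in rnorm X](_ : _ = pcalc (P n) T x - A x); last by rewrite -poly_calcE.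
apply: le_trans (AE x n) _; rewrite ler_piMr //.
by apply: le_trans (rnorm_ge0 _ _) (FP n 0 _); rewrite /closed_disk /= normr0.
Qed.

(** The sequence [q] that witnesses [is_disk_calc] is compared with [p] by von Neumann's inequality,
    so the bound holds for every admissible [A], in particular for the one chosen by [disk_calc]. *)
Lemma is_disk_calc_approx F T A p (e : R) (x : H) :
  op_contraction T -> is_disk_calc F T A ->
  (forall z, closed_disk z -> rnorm (F z - p.[z]) <= e) ->
  `|x| <= 1 -> rnorm (pcalc p T x - A x) <= e.
Proof.
move=> /contractionP hT [_ [q [/uniform_disk_cvgP qF qA]]] Fp x1.
apply/ler_addgt0Pr => d d0; have d2 : 0 < d / 2 by rewrite divr_gt0.
have cd z : circle z -> closed_disk z by rewrite /circle /closed_disk /= => ->.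
have hA : \forall n \near \oo, (opnorm (poly_calc (q n) T - A)%R < (d / 2)%:E)%E.
  apply: (qA [set y | (y < (d / 2)%:E)%E]); apply: open_nbhs_nbhs; split; first
      exact: open_ereal_lt_ereal.
  by rewrite /= lte_fin.
have [n [h1 h2]] := filter_ex (filterI (qF _ d2) hA).
have -> : pcalc p T x - A x = pcalc (p - q n) T x + (pcalc (q n) T x - A x).
  by rewrite pcalcB addrA subrK.
apply: le_trans (rnormD_le _ _ _) _; rewrite (splitr d) addrA lerD //.
  apply: von_neumann_ball => // z /cd hz; rewrite hornerD hornerN.
  have -> : p.[z] - (q n).[z] = (F z - (q n).[z]) - (F z - p.[z]) by ring.
  by apply: le_trans (rnormB_le _ _ _) _; rewrite addrC lerD ?Fp // ltW // h1.
by rewrite -poly_calcE; have /opnorm_leP := ltW h2; apply.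
Qed.

Lemma disk_calcP F T : (exists A, is_disk_calc F T A) -> is_disk_calc F T (disk_calc F T).
Proof. by move=> [A hA]; apply: (getPex (P := [set A | is_disk_calc F T A])); exists A. Qed.

End DiskCalculus.

(** * Lower bounds for omega_star *)

Section OmegaStar.
Context {R : realType}.
Variables (omega : R -> R) (m : nat).
Hypothesis omega_pos : forall x, 0 < x -> 0 < omega x.
Hypothesis omega_nd : forall x y, 0 < x -> x <= y -> omega x <= omega y.
Local Notation mu := (@lebesgue_measure R).
Local Notation g := (fun t : R => (omega t / t ^+ m.+1)%:E : \bar R).

(** [omega] is monotone only on positive numbers; with [Num.max t a] in place of [t] both factors
    become monotone on the whole line and are unchanged on [D]. *)
Let g_measurable (a : R) (D : set R) : 0 < a -> measurable D -> (forall t, D t -> a <= t) ->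
  measurable_fun D (fun t : R => omega t / t ^+ m.+1).
Proof.
move=> a0 mD Da.
have ma (t : R) : 0 < Num.max t a by rewrite lt_max a0 orbT.
apply: (@eq_measurable_fun _ _ _ _ D
    (fun t => omega (Num.max t a) * (Num.max t a ^+ m.+1)^-1)).
  by move=> t; rewrite inE => /Da h; rewrite max_l.
apply: measurable_funM.
  apply: nondecreasing_measurable => // x y xy; apply: omega_nd => //.
  by rewrite ge_max le_max xy /= le_max lexx orbT.
apply: nonincreasing_measurable => // x y xy.
rewrite lef_pV2 ?posrE ?exprn_gt0 // lerXn2r ?nnegrE ?(ltW (ma _)) //.
by rewrite ge_max le_max xy /= le_max lexx orbT.
Qed.

Let g_ge0 (t : R) : 0 < t -> (0 <= g t)%E.
Proof. by move=> t0; rewrite lee_fin divr_ge0 ?exprn_ge0 ?(ltW (omega_pos _ t0))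
    ?(ltW t0). Qed.

(** On this interval of length [a] the integrand is at least [omega a / (2 * a) ^+ m.+1]. *)
Let block (a : R) : 0 < a ->
  ((omega a / (2 ^+ m.+1 * a ^+ m))%:E <= \int[mu]_(t in `[a, (2 * a)%R[) g t)%E.
Proof.
move=> a0; have a2 : a < 2 * a by rewrite ltr_pMl // ltr1n.
have -> : omega a / (2 ^+ m.+1 * a ^+ m) = omega a / (2 * a) ^+ m.+1 * a.
  by rewrite exprMn (exprS a); field; rewrite !expf_neq0 ?gt_eqF.
apply: le_trans (_ : (\int[mu]_(t in `[a, (2 * a)%R[) (cst (omega a / (2 * a) ^+
    m.+1)%R%:E t) <= _)%E).
  rewrite integral_cst //= lebesgue_measure_itv /= lte_fin a2 /= -EFinD -EFinM lee_fin.
  by rewrite le_eqVlt; apply/orP; left; apply/eqP; congr (_ * _); ring.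
apply: ge0_le_integral => //=.
- by move=> t _; rewrite lee_fin divr_ge0 ?exprn_ge0 ?mulr_ge0 ?(ltW (omega_pos _
    a0)) ?(ltW a0).
- by apply/measurable_EFinP; apply: (g_measurable a) => // t /=; rewrite in_itv /=
    => /andP[].
move=> t; rewrite in_itv /= => /andP[at_ t2]; rewrite lee_fin.
have t0 : 0 < t by exact: lt_le_trans at_.
apply: ler_pM => //.
- exact/ltW/omega_pos.
- by rewrite invr_ge0 exprn_ge0 // mulr_ge0 // ltW.
- exact: omega_nd.
- rewrite lef_pV2 ?posrE ?exprn_gt0 ?mulr_gt0 // lerXn2r ?nnegrE ?(ltW t0) ?(ltW t2) //.
  by rewrite ltW // mulr_gt0.
Qed.

Let split_block (a : R) : 0 < a ->
  (\int[mu]_(t in `[a, +oo[) g t =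
   \int[mu]_(t in `[a, (2 * a)%R[) g t + \int[mu]_(t in `[(2 * a)%R, +oo[) g t)%E.
Proof.
move=> a0; have a2 : a <= 2 * a by rewrite ler_peMl ?ltW // ltr1n.
have E : `[a, +oo[%classic = `[a, 2 * a[%classic `|` `[2 * a, +oo[%classic :> set R.
  apply/seteqP; split=> t /=; rewrite !in_itv /= !andbT.
    by move=> ->; have [|] := ltP t (2 * a); [left|right].
  by move=> [/andP[]//|]; exact: le_trans.
rewrite E ge0_integral_setU //=.
- rewrite -E; apply/measurable_EFinP; apply: (g_measurable a) => // t /=; by
    rewrite in_itv /= andbT.
- move=> t h; have : `[a, +oo[%classic t by rewrite E.
  by rewrite /= in_itv /= andbT => h2; apply: g_ge0; exact: lt_le_trans h2.
- apply/disj_setPS => t /= []; rewrite !in_itv /= andbT => /andP[_ h1] h2.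
  by move: h1; rewrite ltNge h2.
Qed.

Let int_ge0 (a : R) : 0 < a -> (0 <= \int[mu]_(t in `[a, +oo[) g t)%E.
Proof.
move=> a0; apply: integral_ge0 => t /=; rewrite in_itv /= andbT => h.
by apply: g_ge0; exact: lt_le_trans h.
Qed.

Lemma omega_starE (x : R) : 0 < x ->
  omega_star omega m x = ((x ^+ m)%:E * \int[mu]_(t in `[x, +oo[) g t)%E.
Proof. by move=> x0; rewrite /omega_star gt_eqF. Qed.

(** The interval from [x] to [2 x] alone suffices. This bound absorbs the remainder [f - P_n]. *)
Lemma omega_star_ge (x : R) : 0 < x ->
  ((omega x)%:E <= (2 ^+ m.+1)%:E * omega_star omega m x)%E.
Proof.
move=> x0; rewrite omega_starE //.
have c0 : 0 < 2 ^+ m.+1 * x ^+ m :> R by rewrite mulr_gt0 // exprn_gt0.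
rewrite muleA -EFinM.
apply: le_trans (_ : ((2 ^+ m.+1 * x ^+ m)%:E * (omega x / (2 ^+ m.+1 * x ^+ m))%:E
    <= _)%E).
  by rewrite -EFinM mulrC divfK // gt_eqF.
rewrite lee_pmul2l ?lte_fin //.
apply: le_trans (block x x0) _; rewrite split_block // leeDl // int_ge0 //.
by rewrite mulr_gt0.
Qed.

(** The intervals from [2^-(j+1)] to [2^-j] with [j < n] are disjoint and lie above [x]; by [block]
    each contributes at least one term of the sum. *)
Lemma omega_star_dyadic (x : R) n : 0 < x -> x <= (2 ^ n)%:R^-1 ->
  ((x ^+ m * \sum_(j < n) (2 ^ j.+1)%:R ^+ m * omega (2 ^ j.+1)%:R^-1)%:E <=
   (2 ^+ m.+1)%:E * omega_star omega m x)%E.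
Proof.
move=> x0 xn; rewrite omega_starE // muleCA EFinM.
rewrite lee_pmul2l ?lte_fin ?exprn_gt0 //.
have p0 k : 0 < (2 ^ k)%:R^-1 :> R by rewrite invr_gt0 ltr0n expn_gt0.
apply: le_trans (_ : ((2 ^+ m.+1)%:E * \int[mu]_(t in `[((2 ^ n)%N%:R^-1)%R, +oo[)
    g t <= _)%E); last first.
  rewrite lee_pmul2l ?lte_fin ?exprn_gt0 //.
  apply: ge0_subset_integral => //=.
  - by apply/measurable_EFinP; apply: (g_measurable x) => // t /=; rewrite in_itv /= andbT.
  - by move=> t; rewrite in_itv /= andbT => h; apply: g_ge0; exact: lt_le_trans h.
  - by move=> t /=; rewrite !in_itv /= !andbT; exact: le_trans.
elim: n {xn} => [|n IH].
  by rewrite big_ord0 mule_ge0 ?lee_fin ?exprn_ge0 // int_ge0 // invr_gt0.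
have e2 : 2 * (2 ^ n.+1)%:R^-1 = (2 ^ n)%:R^-1 :> R.
  by rewrite expnS natrM invfM mulrA divff ?mul1r.
rewrite big_ord_recr /= split_block // e2 ge0_muleDr; last 2 first.
- by apply: integral_ge0 => t /=; rewrite in_itv /= => /andP[h _]; apply: g_ge0;
    exact: lt_le_trans h.
- exact: int_ge0.
rewrite EFinD addeC leeD //.
apply: le_trans (_ : ((2 ^+ m.+1)%:E * (omega (2 ^ n.+1)%:R^-1 / (2 ^+ m.+1 * (2 ^
    n.+1)%:R^-1 ^+ m))%:E <= _)%E).
  rewrite -EFinM lee_fin invfM exprVn invrK.
  rewrite le_eqVlt; apply/orP; left; apply/eqP.
  by field; rewrite expf_neq0.
have := block _ (p0 n.+1); rewrite e2 => hb.
by rewrite lee_pmul2l ?lte_fin ?exprn_gt0.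
Qed.

End OmegaStar.

(** * The theorem *)

Section FinDiff.
Context {R : realType} {V : lmodType R[i]}.

Lemma fin_diff_cst m (v : V) : (0 < m)%N -> fin_diff m (fun=> v) = 0.
Proof.
move=> m0; rewrite /fin_diff -scaler_suml; have := @fin_diff_pow R m 0 m0.
by under eq_bigr do rewrite expr0 mulr1; move=> ->; rewrite scale0r.
Qed.

Lemma fin_diffD m (g h : nat -> V) :
  fin_diff m (fun k => g k + h k) = fin_diff m g + fin_diff m h.
Proof. by rewrite -big_split; apply: eq_bigr => k _; rewrite scalerDr. Qed.

Lemma eq_fin_diff m (g h : nat -> V) : g =1 h -> fin_diff m g = fin_diff m h.
Proof. by move=> gh; apply: eq_bigr => k _; rewrite gh. Qed.

End FinDiff.

Section Lambda.
Context {R : realType}.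
Variables (m : nat) (m_gt0 : (0 < m)%N) (omega : R -> R) (f : R[i] -> R[i]).
Hypothesis omega_pos : forall x, 0 < x -> 0 < omega x.

(** The supremum is not [-oo] because the pair [tau = -1], [zeta = 1] contributes a nonnegative
    value. *)
Lemma Lambda_norm_fin_num : Lambda omega m f -> Lambda_norm omega m f \is a fin_num.
Proof.
move=> [_ fin]; rewrite ge0_fin_numE //.
have c1 : circle (1 : R[i]) by rewrite /circle /= normr1.
apply: (@le_trans _ _ (rnorm (iter m (Delta (-1)) f 1) / omega (rnorm (1 - -1 : R[i])))%:E).
  rewrite lee_fin divr_ge0 ?rnorm_ge0 // ltW // omega_pos //.
  by rewrite opprK -[1 + 1]/(2%:R) -(rmorph_nat (real_complex R)) rnormR ger0_norm.
apply: ereal_sup_ubound; exists (-1), 1; split => //.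
  by rewrite /circle /= normrN normr1.
by rewrite eqNr oner_neq0.
Qed.

Lemma rnorm_Delta_le tau zeta : Lambda omega m f ->
  circle tau -> tau != 1 -> circle zeta ->
  rnorm (iter m (Delta tau) f zeta) <=
  fine (Lambda_norm omega m f) * omega (rnorm (1 - tau)).
Proof.
move=> /Lambda_norm_fin_num fin ct t1 cz.
have w0 : 0 < omega (rnorm (1 - tau)).
  rewrite omega_pos // lt_neqAle rnorm_ge0 andbT eq_sym.
  by apply/eqP => /rnorm_eq0 /subr0_eq e; rewrite e eqxx in t1.
rewrite -ler_pdivrMr // -lee_fin fineK //.
by apply: ereal_sup_ubound; exists tau, zeta.
Qed.

Lemma Lambda_norm_ge0 : Lambda omega m f -> 0 <= fine (Lambda_norm omega m f).
Proof.
move=> hf; have c1 : circle (1 : R[i]) by rewrite /circle /= normr1.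
have cN : circle (-1 : R[i]) by rewrite /circle /= normrN normr1.
have N1 : -1 != 1 :> R[i] by rewrite eqNr oner_neq0.
have := rnorm_Delta_le (-1) 1 hf cN N1 c1; set w := omega _ => h.
have w0 : 0 < w.
  rewrite omega_pos //.
  by rewrite opprK -[1 + 1]/(2%:R) -(rmorph_nat (real_complex R)) rnormR ger0_norm.
by rewrite -(pmulr_lge0 _ w0) (le_trans _ h) // rnorm_ge0.
Qed.

End Lambda.

(** [n] is the least exponent with [4 * s * d * 2 ^ n >= 1]. Unless [n = 0], minimality yields
    [2 * s * d * 2 ^ n < 1], the smallness that [operator_bernstein] asks for; for [n = 0] there is
    no block to estimate. *)
Lemma dyadic_scale {R : realType} (d s : R) : 0 < d -> 0 < s ->
  exists n : nat, ((n == 0)%N || (s * (2 ^ n)%:R * d <= 1 / 2)) /\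
    (2 ^ n)%:R^-1 <= 4 * s * d.
Proof.
move=> d0 s0; have sd : 0 < 4 * s * d by rewrite !mulr_gt0.
have ex : exists n, 1 <= 4 * s * d * (2 ^ n)%:R.
  exists (Num.bound (4 * s * d)^-1).
  have sdV : 0 <= (4 * s * d)^-1 by rewrite invr_ge0 ltW.
  have /ltW h := archi_boundP sdV.
  rewrite -ler_pdivrMl // mulr1; apply: le_trans h _.
  by rewrite ler_nat ltnW // ltn_expl.
case: (ex_minnP ex) => n hn nmin; exists n; split; last first.
  by rewrite -[leLHS]mul1r ler_pdivrMr // ltr0n expn_gt0.
case: n hn nmin => // n hn nmin; apply/orP; right.
have : 4 * s * d * (2 ^ n)%:R < 1.
  by rewrite ltNge; apply/negP => /nmin; rewrite ltnn.
by rewrite expnS natrM; lra.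
Qed.

Section Approximation.
Context {R : realType} {H : hilbertType R}.
Variables (m : nat) (m_gt0 : (0 < m)%N) (T D : {linear H -> H}).
Variables (P : nat -> {poly R[i]}) (w : nat -> R) (C delta : R).
Local Notation s := m.+1.
Local Notation Tk k := (T \+ ((k%:R : R[i]) / m%:R) \*: D).
Hypothesis contraction_segment : forall k, (k <= m)%N -> op_contraction (Tk k).
Hypothesis delta_gt0 : 0 < delta.
Hypothesis D_le : forall x, rnorm (D x) <= delta * rnorm x.
Hypothesis P0 : (size (P 0%N) <= 1)%N.
Hypothesis P_size : forall n, (size (P n) <= s * 2 ^ n)%N.
Hypothesis P_step : forall n z, circle z -> rnorm (P n.+1 - P n).[z] <= C * w n.+1.

(* Bernstein's inequality for every dyadic block, summed by telescoping. *)
Lemma fin_diff_dyadic n (x : H) : `|x| <= 1 ->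
  (n == 0)%N || (s%:R * (2 ^ n)%:R * delta <= 1 / 2) ->
  rnorm (fin_diff m (fun k => pcalc (P n) (Tk k) x)) <=
  expR 1 * 2 ^+ s * C * s%:R ^+ m *
    (delta ^+ m * \sum_(j < n) (2 ^ j.+1)%:R ^+ m * w j.+1).
Proof.
move=> x1; have cT : forall x, rnorm (T x) <= rnorm x.
  have := contraction_segment 0 isT => /contractionP h y.
  by have := h y; rewrite /= mul0r scale0r addr0.
elim: n => [_|n IH /= hn].
  (* [P 0] is a constant polynomial, so its value does not depend on [k] and the difference is 0. *)
  rewrite big_ord0 !mulr0.
  rewrite (@eq_fin_diff _ _ _ _ (fun=> (P 0%N)`_0 *: x)); last first.
    by move=> k; rewrite (pcalc_wide _ _ _ _ P0) big_ord_recl big_ord0 addr0.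
  by rewrite fin_diff_cst // rnorm0.
rewrite (@eq_fin_diff _ _ _ _ (fun k => pcalc (P n.+1 - P n) (Tk k) x + pcalc (P n)
    (Tk k) x)); last first.
  by move=> k; rewrite pcalcB subrK.
rewrite fin_diffD big_ord_recr /=; apply: le_trans (rnormD_le _ _ _) _.
rewrite [leLHS]addrC !mulrDr lerD //.
  apply: IH; case: (n) hn => // n' hn; apply/orP; right.
  apply: le_trans hn; rewrite ler_pM2r // ler_pM2l ?ltr0n // ler_nat.
  by rewrite leq_exp2l.
have e2 : (2 ^ n <= 2 ^ n.+1)%N by rewrite leq_exp2l.
have sz : (size (P n.+1 - P n)%R <= s * 2 ^ n.+1)%N.
  rewrite (leq_trans (size_polyD _ _)) // size_polyN geq_max P_size /=.
  by rewrite (leq_trans (P_size n)) // leq_mul2l e2 orbT.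
have N0 : (0 < s * 2 ^ n.+1)%N by rewrite muln_gt0 expn_gt0.
have Nd : (s * 2 ^ n.+1)%:R * delta <= 1 / 2 by rewrite natrM.
have := operator_bernstein T D (P n.+1 - P n) m _ (C * w n.+1) delta m_gt0 N0 sz
  (P_step n) cT D_le delta_gt0 Nd x.
move/le_trans; apply.
have CW0 : 0 <= C * w n.+1.
  by apply: le_trans (rnorm_ge0 _ _) (P_step n 1 _); rewrite /circle /= normr1.
have x1' : rnorm x <= 1 by rewrite -lecR rnormE.
rewrite natrM !exprMn.
apply: (@le_trans _ _ (expR 1 * 2 ^+ s * (s%:R ^+ m * (2 ^ n.+1)%:R ^+ m * delta ^+
    m) * (C * w n.+1))).
  rewrite ler_piMr // mulr_ge0 //.
  by rewrite !mulr_ge0 ?expR_ge0 ?exprn_ge0 // ltW.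
by rewrite le_eqVlt; apply/orP; left; apply/eqP; ring.
Qed.

End Approximation.

Lemma cvg_dyadic {R : realType} (omega : R -> R) :
  omega x @[x --> 0^'+] --> 0 -> omega (2 ^ n)%:R^-1 @[n --> \oo] --> 0.
Proof.
move=> /cvg_at_rightP; apply; split=> [n|]; first by rewrite invr_gt0 ltr0n expn_gt0.
have -> : (fun n => (2 ^ n)%:R^-1) = geometric (1 : R) 2^-1.
  by apply/funext => n; rewrite /= mul1r natrX exprVn.
by apply: cvg_geometric; rewrite ger0_norm ?invr_ge0 // invf_lt1 // ltr1n.
Qed.

Section Segment.
Context {R : realType} {H : hilbertType R}.

Lemma contraction_segment (T S : {linear H -> H}) (m k : nat) :
  (k <= m)%N -> op_contraction T -> op_contraction S ->
  op_contraction (T \+ ((k%:R : R[i]) / m%:R) \*: (S \- T)).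
Proof.
move=> km /contractionP hT /contractionP hS; apply/contractionP => x /=.
pose t : R := k%:R / m%:R.
have -> : (k%:R : R[i]) / m%:R = t%:C.
  by rewrite /t (rmorphM (real_complex R)) fmorphV !(rmorph_nat (real_complex R)).
have t0 : 0 <= t by rewrite divr_ge0.
have t1 : 0 <= 1 - t.
  rewrite subr_ge0 /t; have [m0|m0] := posnP m; first by rewrite m0 invr0 mulr0.
  by rewrite ler_pdivrMr ?ltr0n // mul1r ler_nat.
have -> : T x + t%:C *: (S x - T x) = (1 - t)%:C *: T x + t%:C *: S x.
  by rewrite (rmorphB (real_complex R)) /= scalerBl scale1r scalerBr addrA addrAC.
apply: le_trans (rnormD_le _ _ _) _; rewrite !rnormZ !rnormR !ger0_norm //.
apply: le_trans (lerD (ler_wpM2l t1 (hT x)) (ler_wpM2l t0 (hS x))) _.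
by rewrite -mulrDl subrK mul1r.
Qed.

Lemma opnorm_subP (T S : {linear H -> H}) : op_contraction T -> op_contraction S ->
  forall x, rnorm ((S \- T) x) <= fine (opnorm (T \- S)) * rnorm x.
Proof.
move=> /contractionP hT /contractionP hS.
have fin : opnorm (T \- S) \is a fin_num.
  rewrite ge0_fin_numE ?opnorm_ge0 //; apply: (@le_lt_trans _ _ (2%:E)) => //; last
      exact: ltry.
  apply/(linear_opnorm_leP (T \- S) 2) => // x /=.
  by apply: le_trans (rnormB_le _ _ _) _; have := hT x; have := hS x; lra.
have f0 : 0 <= fine (opnorm (T \- S)) by rewrite fine_ge0 // opnorm_ge0.
have /(linear_opnorm_leP (T \- S) _ f0) h : (opnorm (T \- S)%R <= (fine (opnorm (T
    \- S)%R))%:E)%E.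
  by rewrite fineK.
by move=> x; rewrite rnorm_distC; exact: h.
Qed.

End Segment.

Theorem theorem11p5 (R : realType) (m : nat) (m_gt0 : (0 < m)%N) :
  exists2 c : R, 0 < c &
  forall omega : R -> R,
    (forall x, 0 < x -> 0 < omega x) ->
    (forall x y, 0 < x -> x <= y -> omega x <= omega y) ->
    omega x @[x --> 0^'+] --> 0 ->
    (forall x, 0 < x -> omega (2 * x) <= 2 ^+ m * omega x) ->
  forall f : R[i] -> R[i], Lambda_plus omega m f ->
  forall (H : hilbertType R) (T S : {linear H -> H}),
    op_contraction T -> op_contraction S ->
    (opnorm (\sum_(k < m.+1) ((-1) ^+ k * 'C(m, k)%:R : R[i]) *:
               disk_calc (disk_ext f) (T \+ (k%:R / m%:R) \*: (S \- T)))%R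
     <= c%:E * Lambda_norm omega m f *
        omega_star omega m (fine (opnorm (T \- S)%R)))%E.
Proof.
pose J : R := @jackson_const R m.
have J0 : 0 < J.
  by rewrite /J /jackson_const mulr_gt0 ?exprn_gt0 // ltr_pwDl // mulr_ge0 ?exprn_ge0.
(* [alpha] serves the remainder: [2 ^+ m] from the difference, [J] from Jackson's estimate, the rest
   from comparing [omega (2^-n)] with [omega delta] when [2^-n <= 4 * m.+1 * delta]. [beta] serves
   the blocks; its [1 + 2 ^+ m] bounds [w k + w k.+1] in terms of [w k.+1]. The further [2 ^+ m.+1]
   in the constant comes from the lower bounds for [omega_star]. *)
pose alpha : R := 2 ^+ m * (J * (2 ^+ m * (1 + (4 * m.+1%:R) ^+ m))).
pose beta : R := expR 1 * 2 ^+ m.+1 * (J * (1 + 2 ^+ m)) * m.+1%:R ^+ m.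
have a0 : 0 < alpha.
  have a1 : 0 < 1 + (4 * m.+1%:R) ^+ m :> R by rewrite ltr_pwDl // exprn_ge0 // mulr_ge0.
  by rewrite /alpha !mulr_gt0 ?exprn_gt0.
have b0 : 0 < beta.
  have b1 : 0 < 1 + 2 ^+ m :> R by rewrite ltr_pwDl // exprn_ge0.
  have b2 : 0 < m.+1%:R ^+ m :> R by rewrite exprn_gt0 // ltr0n.
  by rewrite /beta !mulr_gt0 ?exprn_gt0 ?expR_gt0.
exists ((alpha + beta) * 2 ^+ m.+1); first by rewrite mulr_gt0 ?addr_gt0 ?exprn_gt0.
move=> omega wpos wnd w0 wdb f [Lf f_neg] H T S hT hS.
have [cf _] := Lf.
set L := fine (Lambda_norm omega m f).
have L0 : 0 <= L by exact: Lambda_norm_ge0.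
have -> : Lambda_norm omega m f = L%:E by rewrite fineK // Lambda_norm_fin_num.
pose P n := jackson_poly m f (2 ^ n).
pose w n := omega ((2 ^ n)%:R^-1 : R).
pose e n := J * L * w n.
have wp n : 0 < w n by rewrite wpos // invr_gt0 ltr0n expn_gt0.
have fP n z : circle z -> rnorm (f z - (P n).[z]) <= e n.
  move=> cz; apply: jackson_approx => //; last by rewrite expn_gt0.
  by move=> tau zeta ct t1 cz'; apply: rnorm_Delta_le.
have e0 : e n @[n --> \oo] --> 0.
  rewrite -(mulr0 (J * L)); apply: cvgM; first exact: cvg_cst.
  exact: cvg_dyadic w0.
have FP := disk_ext_approx f P e cf e0 fP.
set delta := fine (opnorm (T \- S)).
have dle := opnorm_subP T S hT hS.
have d0 : 0 <= delta by rewrite fine_ge0 // opnorm_ge0.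
pose Tk k := T \+ ((k%:R : R[i]) / m%:R) \*: (S \- T).
have hTk k : (k <= m)%N -> op_contraction (Tk k).
  by move=> km; exact: contraction_segment.
pose A k := disk_calc (disk_ext f) (Tk k).
have sumE (x : H) : (\sum_(k < m.+1) ((-1) ^+ k * 'C(m, k)%:R : R[i]) *:
    disk_calc (disk_ext f) (T \+ (k%:R / m%:R) \*: (S \- T))) x =
    fin_diff m (fun k => A k x).
  by rewrite fct_sumE.
have hA k : (k <= m)%N -> is_disk_calc (disk_ext f) (Tk k) (A k).
  move=> km; apply: disk_calcP.
  exact: (is_disk_calc_ex (disk_ext f) P e _ (hTk k km) e0 FP).
(* For [delta = 0] the right-hand side is 0 and the sum has to vanish exactly: [S] and [T] agree, so
   all points of the segment coincide and the difference of a constant is 0. *)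
have [d00|dn0] := eqVneq delta 0.
  rewrite d00 /omega_star eqxx mule0; apply/opnorm_leP => x _; rewrite sumE.
  rewrite (@eq_fin_diff _ _ _ _ (fun=> disk_calc (disk_ext f) T x)) ?fin_diff_cst
      ?rnorm0 // => k.
  rewrite /A; congr disk_calc; apply/funext => y.
  rewrite /Tk /= (_ : S y - T y = 0) ?scaler0 ?addr0 //.
  apply/rnorm_eq0/eqP; rewrite eq_le rnorm_ge0 andbT.
  by have := dle y; rewrite -/delta d00 mul0r.
have dpos : 0 < delta by rewrite lt_neqAle eq_sym dn0.
have [n [hn dn]] := dyadic_scale delta m.+1%:R dpos (ltr0Sn _ _).
have wstep k : w k <= 2 ^+ m * w k.+1.
  have := wdb (2 ^ k.+1)%:R^-1; rewrite invr_gt0 ltr0n expn_gt0 => /(_ isT).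
  by rewrite {1}expnS natrM invfM mulrA divff ?mul1r.
have Pstep k z : circle z -> rnorm (P k.+1 - P k).[z] <= J * L * (1 + 2 ^+ m) * w k.+1.
  move=> cz; rewrite hornerD (hornerN (P k)).
  have -> : (P k.+1).[z] - (P k).[z] = (f z - (P k).[z]) - (f z - (P k.+1).[z]) by ring.
  apply: le_trans (rnormB_le _ _ _) _; apply: le_trans (lerD (fP _ _ cz) (fP _ _ cz)) _.
  rewrite /e -mulrDr -[leRHS]mulrA ler_wpM2l ?mulr_ge0 ?(ltW J0) //.
  by rewrite mulrDl mul1r addrC lerD.
have Psize k : (size (P k) <= m.+1 * 2 ^ k)%N.
  apply: leq_trans (size_jackson_poly m f _) _.
  have : (0 < 2 ^ k)%N by rewrite expn_gt0.
  by case: (2 ^ k)%N => // M _; rewrite /= (mulnC M) (mulnS m.+1 M) addSn ltnS leq_addl.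
pose Sig := delta ^+ m * \sum_(j < n) (2 ^ j.+1)%:R ^+ m * w j.+1.
have main : (opnorm (\sum_(k < m.+1) ((-1) ^+ k * 'C(m, k)%:R : R[i]) *:
    disk_calc (disk_ext f) (T \+ (k%:R / m%:R) \*: (S \- T)))%R
    <= (L * (alpha * omega delta + beta * Sig))%:E)%E.
  apply/opnorm_leP => x x1; rewrite sumE.
  rewrite (@eq_fin_diff _ _ _ _ (fun k => (A k x - pcalc (P n) (Tk k) x) + pcalc (P
      n) (Tk k) x)); last first.
    by move=> k; rewrite subrK.
  rewrite fin_diffD; apply: le_trans (rnormD_le _ _ _) _; rewrite mulrDr lerD //.
    apply: le_trans (_ : 2 ^+ m * e n <= _).
      apply: rnorm_fin_diff => k km; rewrite rnorm_distC.
      by apply: (is_disk_calc_approx (disk_ext f) (Tk k)) => //; [exact: hTk|exact: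
          hA|exact: FP].
    have wn : w n <= 2 ^+ m * (1 + (4 * m.+1%:R) ^+ m) * omega delta.
      have pn : 0 < (2 ^ n)%:R^-1 :> R by rewrite invr_gt0 ltr0n expn_gt0.
      apply: le_trans (omega_growth omega m delta _ wpos wnd wdb dpos pn) _.
      rewrite ler_wpM2r ?(ltW (wpos _ dpos)) // ler_wpM2l ?exprn_ge0 // lerD2l.
      have q0 : 0 <= (2 ^ n)%:R^-1 / delta by rewrite divr_ge0 // ltW.
      have q1 : (2 ^ n)%:R^-1 / delta <= 4 * m.+1%:R by rewrite ler_pdivrMr.
      by rewrite lerXn2r ?nnegrE ?(le_trans q0 q1).
    apply: le_trans (_ : 2 ^+ m * (J * L * (2 ^+ m * (1 + (4 * m.+1%:R) ^+ m) *
        omega delta)) <= _).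
      by rewrite ler_wpM2l ?exprn_ge0 // ler_wpM2l // mulr_ge0 // ltW.
    by rewrite /alpha le_eqVlt; apply/orP; left; apply/eqP; ring.
  apply: le_trans (fin_diff_dyadic m m_gt0 T (S \- T) P w _ delta hTk dpos dle _
      Psize Pstep n x x1 hn) _.
    exact: (size_jackson_poly m f 1).
  by rewrite /beta /Sig le_eqVlt; apply/orP; left; apply/eqP; ring.
apply: le_trans main _; set W := omega_star omega m delta.
(* [W] may be [+oo], so the remaining comparison stays in the extended reals. *)
pose W' := ((2 ^+ m.+1)%:E * W)%E.
have h1 : ((omega delta)%:E <= W')%E by exact: omega_star_ge.
have W'0 : (0 <= W')%E by apply: le_trans h1; rewrite lee_fin ltW // wpos.
have h2 : (Sig%:E <= W')%E.
  (* For [n > 0] the bound [m.+1 * 2 ^ n * delta <= 1 / 2] contains [delta <= 2^-n], as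
     [omega_star_dyadic] requires; for [n = 0] the sum is empty. *)
  move: hn; rewrite /Sig; case: (n) => [_|n']; first by rewrite big_ord0 mulr0.
  move=> /= hn; apply: omega_star_dyadic => //.
  rewrite -[leRHS]mul1r ler_pdivlMr ?ltr0n ?expn_gt0 // mulrC.
  have q0 : 0 <= (2 ^ n'.+1)%:R * delta by rewrite mulr_ge0 // ltW.
  have : (2 ^ n'.+1)%:R * delta <= m.+1%:R * ((2 ^ n'.+1)%:R * delta).
    by rewrite ler_peMl // ler1n.
  by rewrite mulrA; lra.
have -> : (((alpha + beta) * 2 ^+ m.+1)%:E * L%:E * W = L%:E * ((alpha + beta)%:E * W'))%E.
  by rewrite /W' (muleC _ L%:E) EFinM !muleA.
rewrite EFinM; apply: lee_wpmul2l; first by rewrite lee_fin.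
rewrite !EFinD !EFinM ge0_muleDl ?lee_fin ?(ltW a0) ?(ltW b0) //.
by apply: leeD; apply: lee_wpmul2l => //; rewrite lee_fin ltW.
Qed.
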